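(* Let $h\ge 2$ be an integer and let $\theta$ be a real number with $1/h<\theta\le 1/(h-1)$. Then there exists a strongly minimal asymptotic basis $A\subseteq\mathbb N_0$ of order $h$ such that $A(x)\asymp x^\theta$.
   Context: $\mathbb N_0$ is the set of nonnegative integers. For $A\subseteq\mathbb N_0$, real $x\ge1$ and a positive integer $h$, put $A(x)=|A\cap[0,x]|$ and $hA=\{a_1+\cdots+a_h:a_1,\ldots,a_h\in A\}$ (repetitions allowed). $A$ is an asymptotic basis of order $h$ if $hA$ contains every sufficiently large integer. For $a\in A$ put $E_a=hA\setminus h(A\setminus\{a\})$ and $E_a(x)=|E_a\cap[0,x]|$. An asymptotic basis $A$ of order $h$ is called strongly minimal if $E_a(x)\gg_a A(x)^{h-1}$ for every $a\in A$, i.e. for every $a\in A$ there is a constant $c_a>0$ with $E_a(x)\ge c_aA(x)^{h-1}$ for all sufficiently large $x$. $A(x)\asymp x^\theta$ means that there are constants $0<c<c'$ with $cx^\theta\le A(x)\le c'x^\theta$ for all sufficiently large $x$. *)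

(* Defs.v *)
From mathcomp Require Import all_boot all_order all_algebra finmap.
From mathcomp Require Import all_classical all_reals all_analysis.

Set Implicit Arguments.
Unset Strict Implicit.
Unset Printing Implicit Defensive.

Import Order.TTheory GRing.Theory Num.Theory.
Import numFieldNormedType.Exports.

Local Open Scope classical_set_scope.
Local Open Scope ring_scope.

(* The set [0, x] meets nat in a finite set, so [fset_set], which is the empty
   finite set on infinite sets, never takes its default value here. *)
Definition count_upto (R : realType) (A : set nat) (x : R) : nat :=
  #|` fset_set (A `&` [set n : nat | n%:R <= x]) |.

Definition sumset (h : nat) (A : set nat) : set nat :=
  [set n | exists2 a : 'I_h -> nat, forall i, A (a i) & n = (\sum_(i < h) a i)%N].

Definition asymptotic_basis (h : nat) (A : set nat) : Prop :=
  \forall n \near \oo, sumset h A n.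

(* The set E_a of h-fold sums all of whose representations use a. *)
Definition sums_needing (h : nat) (A : set nat) (a : nat) : set nat :=
  sumset h A `\` sumset h (A `\ a).

Definition strongly_minimal_basis (R : realType) (h : nat) (A : set nat) : Prop :=
  asymptotic_basis h A /\
  forall a : nat, A a -> exists2 c : R, 0 < c &
    \forall x \near +oo,
      c * (count_upto A (x : R))%:R ^+ (h - 1)%N <= (count_upto (sums_needing h A a) x)%:R.

Definition asymp_powR (R : realType) (f : R -> R) (theta : R) : Prop :=
  exists c c' : R, [/\ 0 < c, c < c' &
    \forall x \near +oo, c * x `^ theta <= f x <= c' * x `^ theta].

(* Main.v *)
(* Work in base g = h + 1 and build A in stages s; the elements of stage s have the
   form l g^k + (a restricted k-digit number), k a fixed multiple of s, with a bounded
   "lead" l.  The digit positions below k are shared out among h roles, each owning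
   about theta k of them, so that a stage has O(g^(theta k)) elements, while h elements
   of different roles add up without carry to an arbitrary k-digit tail.

   Normal leads are chosen so that sums of h of them reach every size except a short
   window around one value lambda.  There, h families of c-elements take over, with
   leads locked together by powers of g: a representation of a number with lead lambda
   by c-elements uses each role of one family q exactly once.  A special tail of stage
   s (the predicate pat) encodes a fixed earlier element a = ty s in its low digits, and
   family q may not contain the q-digits of any special tail.  Hence a number with lead
   lambda and special tail has only the representations a + (h - 1 b-elements); the
   low digits of the b-elements force the remaining summand to be congruent to a, and
   A is so sparse in that residue class that it is a.  Every other number in the
   window is still a sum of c-elements, since its tail differs from the special ones on
   the digits of some role q.  The special tails of stage s are free in about
   (h - 1) theta k digits, and each a is the type of stages s in an arithmetic
   progression, so E_a(x) >> x^((h - 1) theta) >> A(x)^(h - 1). *)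

Require Import Defs.
From Stdlib Require Import Classical.
From mathcomp Require Import all_boot zify.

Set Implicit Arguments.
Unset Strict Implicit.
Unset Printing Implicit Defensive.

(** * Digits *)

Section Digits.
Variable g : nat.
Hypothesis g_gt1 : 1 < g.

Definition num k (d : nat -> nat) := \sum_(w < k) d w * g ^ w.
Definition digit n w := n %/ g ^ w %% g.

Let g_gt0 : 0 < g. Proof. exact: ltnW. Qed.

Lemma numS k d : num k.+1 d = num k d + d k * g ^ k.
Proof. by rewrite /num big_ord_recr. Qed.

Lemma eq_num k d d' : (forall w, w < k -> d w = d' w) -> num k d = num k d'.
Proof. by move=> E; apply: eq_bigr => w _; rewrite E. Qed.

Lemma numD k d d' : num k (fun w => d w + d' w) = num k d + num k d'.
Proof. by rewrite /num -big_split; apply: eq_bigr => w _; rewrite mulnDl. Qed.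

Lemma numZ k c d : num k (fun w => c * d w) = c * num k d.
Proof. by rewrite /num big_distrr; apply: eq_bigr => w _; rewrite /= mulnA. Qed.

Lemma num_sum k (I : finType) (d : I -> nat -> nat) :
  num k (fun w => \sum_i d i w) = \sum_i num k (d i).
Proof.
by rewrite /num exchange_big; apply: eq_bigr => w _; rewrite big_distrl.
Qed.

Lemma ltn_num k d : (forall w, w < k -> d w < g) -> num k d < g ^ k.
Proof.
elim: k => [|k IHk] d_lt; first by rewrite /num big_ord0.
rewrite numS expnS.
have := IHk (fun w lt_w_k => d_lt w (ltnW lt_w_k)).
have : d k * g ^ k <= g.-1 * g ^ k by rewrite leq_mul2r; have := d_lt k; lia.
by have -> : g * g ^ k = g.-1 * g ^ k + g ^ k; [rewrite -mulSnr prednK|lia].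
Qed.

Lemma num_ext j k d : j <= k ->
  exists q, num k d = q * g ^ j + num j d.
Proof.
elim: k => [|k IHk]; first by rewrite leqn0 => /eqP->; exists 0.
rewrite leq_eqVlt => /predU1P[->|lt_jk]; first by exists 0.
have [q Eq] := IHk lt_jk; rewrite numS Eq.
exists (q + d k * g ^ (k - j)).
by rewrite mulnDl -mulnA -expnD subnK //; lia.
Qed.

Lemma num_tail j k d : j <= k -> (forall w, j <= w < k -> d w = 0) ->
  num k d = num j d.
Proof.
elim: k => [|k IHk]; first by rewrite leqn0 => /eqP->.
rewrite leq_eqVlt => /predU1P[->//|le_jk] d0.
rewrite numS d0 ?ltnSn ?andbT // addn0 IHk // => w /andP[le_w lt_w].
by rewrite d0 // le_w ltnW.
Qed.

Lemma leq_exp_num k d w : w < k -> 0 < d w -> g ^ w <= num k d.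
Proof.
move=> lt_w dw; rewrite /num (bigD1 (Ordinal lt_w)) //=.
by rewrite (leq_trans _ (leq_addr _ _)) // leq_pmull.
Qed.

Lemma modn_num j k q d : j <= k -> (forall w, w < j -> d w < g) ->
  (q * g ^ k + num k d) %% g ^ j = num j d.
Proof.
move=> le_jk d_lt; have [q' ->] := num_ext d le_jk.
rewrite -(subnK le_jk) expnD mulnA addnA -mulnDl modnMDl modn_small //.
exact: ltn_num.
Qed.

Lemma digit_modn n w j : w < j -> digit (n %% g ^ j) w = digit n w.
Proof.
move=> lt_wj; rewrite /digit {2}(divn_eq n (g ^ j)).
have -> : g ^ j = g ^ (j - w.+1) * g * g ^ w.
  by rewrite -mulnA -expnS -expnD subnK.
by rewrite !mulnA divnMDl ?expn_gt0 ?g_gt0 // modnMDl.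
Qed.

Lemma digit_num k q d w : w < k -> (forall w, w < k -> d w < g) ->
  digit (q * g ^ k + num k d) w = d w.
Proof.
move=> lt_wk d_lt.
rewrite -(@digit_modn _ w w.+1) // modn_num //; last first.
  by move=> w' lt_w'; apply: d_lt; lia.
rewrite numS /digit addnC divnMDl ?expn_gt0 ?g_gt0 // divn_small.
  by rewrite addn0 modn_small // d_lt.
by apply: ltn_num => w' lt_w'; apply: d_lt; lia.
Qed.

Lemma num_inj k d d' : (forall w, w < k -> d w < g) ->
  (forall w, w < k -> d' w < g) -> num k d = num k d' ->
  forall w, w < k -> d w = d' w.
Proof.
move=> d_lt d'_lt Ed w lt_wk.
by rewrite -(@digit_num k 0 d) // mul0n add0n Ed -(@digit_num k 0 d').
Qed.

Lemma digit_lt n w : digit n w < g.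
Proof. by rewrite ltn_mod. Qed.

Lemma num_digit k n : num k (digit n) = n %% g ^ k.
Proof.
elim: k => [|k IHk]; first by rewrite /num big_ord0 modn1.
rewrite numS IHk /digit addnC expnSr.
rewrite {3}(divn_eq n (g ^ k)) {2}(divn_eq (n %/ g ^ k) g).
rewrite mulnDl -mulnA (mulnC g) -addnA modnMDl [RHS]modn_small //.
have: (n %/ g ^ k) %% g * g ^ k <= g.-1 * g ^ k.
  by rewrite leq_mul2r -ltnS prednK // ltn_mod g_gt0 orbT.
have : n %% g ^ k < g ^ k by rewrite ltn_mod expn_gt0 g_gt0.
have -> : g ^ k * g = g.-1 * g ^ k + g ^ k by rewrite -mulSnr prednK // mulnC.
by lia.
Qed.

Lemma leq_modn_digit n s j : s < j -> 0 < digit n s -> g ^ s <= n %% g ^ j.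
Proof.
move=> lt_sj; rewrite -(@digit_modn _ s j) // [g ^ s <= _]leqNgt; apply: contraTN => lt_n.
by rewrite /digit divn_small // mod0n.
Qed.

Lemma leq_modn_exp n i j : i <= j -> n %% g ^ i <= n %% g ^ j.
Proof.
move=> le_ij; rewrite -(@modn_dvdm (g ^ j) n (g ^ i)) ?leq_mod //.
by rewrite dvdn_exp2l.
Qed.

(** A digit of at most g - 2 at p absorbs one more g ^ p without overflow. This controls the carries
    caused by markers in [stage_isolated]. *)
Lemma num_digit_gap w p d : p < w -> (forall w', w' < w -> d w' < g) ->
  (d p).+1 < g -> num w d + g ^ p < g ^ w.
Proof.
move=> lt_pw d_lt dp_lt.
have -> : g ^ p = num w (fun w => w == p).
  rewrite /num (bigD1 (Ordinal lt_pw)) //= eqxx mul1n big1 ?addn0 // => i.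
  by rewrite -val_eqE /= => /negPf->.
rewrite -numD; apply: ltn_num => w' lt_w'.
by case: eqP => [->|_]; rewrite ?addn1 ?addn0 // d_lt.
Qed.

(** Fewer than g powers of g add up without carry, so their sum determines the multiplicity of each
    exponent. *)
Lemma digit_sum_exp (I : finType) (A : {set I}) (p : I -> nat) P :
  #|A| < g -> digit (\sum_(i in A) g ^ p i) P = #|[set i in A | p i == P]|.
Proof.
move=> A_lt.
rewrite (bigID (fun i => p i < P)) /= addnC.
rewrite (bigID (fun i => p i == P)) /=.
have -> : \sum_(i | (i \in A) && ~~ (p i < P) && (p i == P)) g ^ p i =
          #|[set i in A | p i == P]| * g ^ P.
  rewrite -sum_nat_const; apply: eq_big => [i|i /andP[_ /eqP->]] //.
  by rewrite inE; case: eqP => [->|]; rewrite ?ltnn ?andbT ?andbF.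
have [q ->] : exists q, \sum_(i | (i \in A) && ~~ (p i < P) && (p i != P)) g ^ p i =
                        q * g ^ P.+1.
  exists (\sum_(i | (i \in A) && ~~ (p i < P) && (p i != P)) g ^ (p i - P.+1)).
  rewrite big_distrl; apply: eq_bigr => i /andP[/andP[_ le_Pi] ne_Pi].
  by rewrite /= -expnD subnK //; lia.
have lt_low : \sum_(i in A | p i < P) g ^ p i < g ^ P.
  case: P => [|P]; first by rewrite big_pred0 ?expn0 // => i; rewrite ltn0 andbF.
  apply: (@leq_ltn_trans (\sum_(i in A) g ^ P)).
    rewrite big_mkcondr; apply: leq_sum => i _; case: ifP => // lt_i.
    by rewrite leq_exp2l.
  by rewrite sum_nat_const expnS ltn_mul2r expn_gt0 g_gt0.
have card_lt : #|[set i in A | p i == P]| < g.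
  apply: leq_ltn_trans A_lt; apply/subset_leq_card/subsetP => i.
  by rewrite inE => /andP[].
rewrite /digit expnS mulnA -mulnDl divnMDl ?expn_gt0 ?g_gt0 //.
by rewrite divn_small // addn0 addnC modnMDl modn_small.
Qed.

End Digits.

(** * Leads *)

Section Leads.
Variable h : nat.
Hypothesis h_gt1 : 1 < h.

(* A lead l is described by D and O with [l + ze = D * HH + O].  As [h * ze = gp + ze],
   h leads add up to lambda = [lamb] iff the sums of D and O are vv and ze: HH exceeds all
   sums of O that occur.  The offset O tells the kinds apart: about ze for normal
   leads, 0 for b-leads and about gm = ze / h for c-leads. *)
Definition gm := 4 * h + 2.
Definition ze := h * gm.
Definition gp := h * ((h - 1) * gm).
Definition Em := 2 * h.
Definition Ep := gp + h.
Definition yy := h * (ze + gm + Ep) + gp + 4 * h + 2.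
Definition HH := h * yy.
Definition ye := yy - gp - 2 * h.
Definition MM := h.+1 ^ (h * h).
Definition d0 := 2 * MM.
Definition vv := h * d0 + 2.
Definition ee := h * d0 + 1.
Definition lamb := vv * HH - gp.
(* The D of the c-lead of family q and role r; the role r = q takes the complement to vv
   ([cbig]). *)
Definition cd q r := h.+1 ^ (q * h + r + 1).
Definition cbig q := vv - \sum_(r < h | r != q :> nat) cd q r.

(* KN: normal, or from an earlier stage (then D = 0); KB: b-lead; KC q r: c-lead of family q
   and role r. *)
Inductive kind := KN | KB | KC of nat & nat.
Definition isN K := if K is KN then true else false.
Definition isB K := if K is KB then true else false.
Definition isC K := if K is KC _ _ then true else false.

Definition lead_ok K D O : Prop := match K with
  | KN => [\/ D = 0 /\ ze <= O <= ze + yy,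
              1 <= D <= d0 /\ ze - h <= O <= ze + yy
            | D = ee /\ ze - h <= O <= ze + ye]
  | KB => O = 0 /\ (D = 1 \/ D = vv - (h - 2))
  | KC q r => [/\ q < h, r < h &
      if q == r then D = cbig q /\ gm - Em <= O <= gm + Ep
      else D = cd q r /\ O = gm]
  end.

Lemma ze_gp : h * ze = gp + ze.
Proof. by rewrite /gp /ze; nia. Qed.

Lemma cd_le q r : q < h -> r < h -> 0 < cd q r <= MM.
Proof.
move=> lt_q lt_r; rewrite expn_gt0 /= leq_exp2l //; last by lia.
have : q.+1 * h <= h * h by rewrite leq_mul2r lt_q orbT.
by rewrite mulSn; lia.
Qed.

Lemma sum_cd_le q : q < h -> \sum_(r < h | r != q :> nat) cd q r <= h * MM.
Proof.
move=> lt_q; rewrite -[h in h * _]card_ord -sum_nat_const big_mkcond /=.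
apply: leq_sum => r _; case: ifP => // _.
by have /andP[] := cd_le lt_q (ltn_ord r).
Qed.

Lemma MM_gt : h < MM.
Proof.
apply: (@leq_trans (h.+1 ^ 1)); first by rewrite expn1.
by rewrite leq_exp2l //; nia.
Qed.

Lemma gp_HH : gp + 2 * h < HH. Proof. by rewrite /HH /yy; nia. Qed.

Lemma gp_vvHH : gp <= vv * HH. Proof. by rewrite /vv; have := gp_HH; nia. Qed.

Lemma lamb_le : lamb + 2 <= vv * HH.
Proof. by have := gp_vvHH; have : 2 <= gp; rewrite /lamb; [rewrite /gp /gm; nia | lia]. Qed.

Lemma vvHH : vv * HH = h * (HH * d0) + HH + HH.
Proof. by rewrite /vv; nia. Qed.

Lemma eeHH : ee * HH + HH = vv * HH.
Proof. by rewrite /vv /ee; nia. Qed.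

Lemma gp_gt : h * h + 1 < gp.
Proof. by rewrite /gp /gm; nia. Qed.

Lemma yy_gt : (h - 1) * (ze + yy) + h * (gm + Ep) + 2 * h < HH + ze.
Proof.
have -> : HH = (h - 1) * yy + yy.
  by rewrite -mulSnr /HH; congr (_ * _); lia.
have : h * ze + h * (gm + Ep) + 2 * h < yy by rewrite /yy; nia.
have : (h - 1) * ze <= h * ze by rewrite leq_mul2r leq_subr orbT.
by rewrite mulnDr; lia.
Qed.

Lemma ye_yy : ye + gp + 2 * h = yy.
Proof. by rewrite /ye /yy; nia. Qed.

Lemma vv_gt : 2 * (h * MM) < vv. Proof. by rewrite /vv /d0; nia. Qed.

(* Only one of the leads can be large, its D is then cbig q, and the D of the others are
   the base h + 1 digits of what is missing. *)
Lemma leads_rigid (K : 'I_h -> kind) (D O : 'I_h -> nat) :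
  (forall i, lead_ok (K i) (D i) (O i)) -> (forall i, ~~ isN (K i)) ->
  \sum_i D i = vv ->
  exists2 q, q < h & exists2 f : 'I_h -> 'I_h, injective f &
    forall r, K (f r) = KC q r.
Proof.
move=> okK noN sumD.
(* A small D i is a power of h + 1 with exponent [p i]. The exponents in [cd] start at 1, which
   leaves 0 to the b-leads with D = 1. *)
pose p i := if K i is KC q r then q * h + r + 1 else 0.
pose big i := if K i is KC q r then q == r else D i != 1.
have gtV := vv_gt; have gtM := MM_gt.
have small i : ~~ big i -> D i = h.+1 ^ p i /\ D i <= MM.
  have := okK i; have := noN i; rewrite /big /p.
  case: (K i) => // [|q r] _ /=; first by move=> _ /negPn/eqP->; split=> //; lia.
  case=> lt_q lt_r /[swap] /negPf-> [-> _]; split=> //.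
  by have /andP[] := cd_le lt_q lt_r.
have large i : big i -> vv <= D i + h * MM.
  have := okK i; have := noN i; rewrite /big.
  case: (K i) => // [|q r] _ /=.
    case=> _ [->|->] // _; have : h - 2 <= h * MM by nia.
    by lia.
  case=> lt_q _ /[swap] /eqP<-; rewrite eqxx => -[-> _].
  by have := sum_cd_le lt_q; rewrite /cbig; lia.
have Dpos i : 0 < D i.
  case: (boolP (big i)) => [/large|/small[-> _]]; last by rewrite expn_gt0.
  by lia.
have [i0 big0] : exists i0 : 'I_h, big i0.
  apply/existsP; apply: contraLR isT => noBig.
  have : \sum_i D i <= \sum_(i < h) MM.
    apply: leq_sum => i _; have [|//] := small i.
    by apply: contra noBig => bi; apply/existsP; exists i.
  by rewrite sumD sum_nat_const card_ord; lia.
have unique i : i != i0 -> ~~ big i.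
  move=> ne_i; apply: contraL isT => bigi.
  have := large _ bigi; have := large _ big0.
  by move: sumD; rewrite (bigD1 i0) // (bigD1 i) //=; lia.
(* A large b-lead has D = vv - (h - 2), which leaves only h - 2 for the h - 1 other leads, each with
   D at least 1. *)
have [q [lt_q Ki0]] : exists q, q < h /\ K i0 = KC q q.
  have := okK i0; have := noN i0; move: (big0); rewrite /big.
  case: (K i0) => [//|/eqP ne1 _ /= [_ [//|D0]]|q r /eqP<- _ [lt_q _ _]]; last by exists q.
  have : \sum_(i < h | i != i0) 1 <= \sum_(i < h | i != i0) D i by apply: leq_sum.
  rewrite sum1_card cardC1 card_ord.
  have : h <= h * MM by rewrite leq_pmulr; lia.
  move: sumD; rewrite (bigD1 i0) //= D0.
  by move: (\sum_(i < h | i != i0) D i) => S; lia.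
have sumE : \sum_(i in [set~ i0]) h.+1 ^ p i =
            \sum_(r in [set r : 'I_h | r != q :> nat]) h.+1 ^ (q * h + r + 1).
  have -> : \sum_(i in [set~ i0]) h.+1 ^ p i = \sum_(i < h | i != i0) D i.
    apply: eq_big => [i|i]; first by rewrite !inE.
    by rewrite !inE => /unique/small[].
  have -> : \sum_(r in [set r : 'I_h | r != q :> nat]) h.+1 ^ (q * h + r + 1)
            = \sum_(r < h | r != q :> nat) cd q r.
    by apply: eq_bigl => r; rewrite inE.
  have := okK i0; rewrite Ki0 /= eqxx => -[_ _ [D0 _]].
  have := sum_cd_le lt_q; move: sumD; rewrite (bigD1 i0) //= D0 /cbig.
  move: (\sum_(i < h | i != i0) D i) (\sum_(r < h | r != q :> nat) cd q r).
  by move=> S T; lia.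
(* Role q is taken by i0. For r other than q, compare the base h + 1 digits at q h + r + 1 on both
   sides of [sumE]. *)
have occ (r : 'I_h) : exists i, K i = KC q r.
  have [->|ne_r] := eqVneq (r : nat) q; first by exists i0.
  have lt1 : #|[set~ i0]| < h.+1 by rewrite cardsC1 card_ord; lia.
  have lt2 : #|[set r : 'I_h | r != q :> nat]| < h.+1.
    by rewrite ltnS (leq_trans (max_card _)) ?card_ord.
  have hS_gt1 : 1 < h.+1 by lia.
  have := digit_sum_exp hS_gt1 p (q * h + r + 1) lt1; rewrite sumE.
  rewrite digit_sum_exp // => Ecard.
  have : 0 < #|[set i in [set~ i0] | p i == q * h + r + 1]|.
    by rewrite -Ecard card_gt0; apply/set0Pn; exists r; rewrite !inE ne_r eqxx.
  rewrite card_gt0 => /set0Pn[i]; rewrite !inE => /andP[_ /eqP].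
  rewrite /p; have := okK i; case Ki: (K i) => [||q' r'] /=; try lia.
  case=> lt_q' lt_r' _ /addIn E; exists i; rewrite Ki.
  have Eq : q' = q by have := congr1 (divn^~ h) E; rewrite !divnMDl ?divn_small // ?addn0 //; lia.
  by move: E; rewrite Eq => /addnI->.
exists q => //; have [f Ef] := fin_all_exists occ; exists f => // r1 r2 Er.
by have := Ef r1; rewrite Er Ef => -[/val_inj].
Qed.

(** The sum of the leads may differ from lambda, because an element with lead l lies anywhere from l
    g^k up to (l + 2) g^k. Sums of normal leads alone miss this range. Otherwise the D must add up
    to vv, and the offsets then leave no room for a normal lead unless all other leads are
    b-leads. *)
Lemma window_sum_forced (K : 'I_h -> kind) (D O l : 'I_h -> nat) :
  (forall i, lead_ok (K i) (D i) (O i)) ->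
  (forall i, l i + ze = D i * HH + O i) ->
  lamb < \sum_i l i + 2 * h -> \sum_i l i <= lamb + 1 ->
  h - 2 < \sum_i isB (K i) \/
  exists2 q, q < h & exists2 f : 'I_h -> 'I_h, injective f &
    forall r, K (f r) = KC q r.
Proof.
move=> okK El lo hi.
case: (ltnP (h - 2) (\sum_i isB (K i))) => [manyB|fewB]; [by left|right].
have sumE : \sum_i l i + h * ze = HH * \sum_i D i + \sum_i O i.
  rewrite -[h in h * ze]card_ord -sum_nat_const -big_split /=.
  rewrite big_distrr -big_split; apply: eq_bigr => i _.
  by rewrite /= El mulnC.
have lambE : lamb + gp = vv * HH.
  by rewrite subnK // gp_vvHH.
have Egp := ze_gp.
set SD := \sum_i D i in sumE; set SO := \sum_i O i in sumE.
have sum3 : \sum_i isN (K i) + \sum_i isB (K i) + \sum_i isC (K i) = h.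
  rewrite -[RHS]card_ord -sum1_card -!big_split.
  by apply: eq_bigr => i _; case: (K i).
have O_ub i : O i <= isN (K i) * (ze + yy) + (gm + Ep).
  have := okK i; case: (K i) => [|| q r] /=; rewrite ?mul1n ?mul0n;
    [case=> -[_ HO] | case=> HO _ | case=> _ _; case: ifP => _ [_ HO]];
    by rewrite /ye in HO *; lia.
have O_lb i : isN (K i) * (ze - h) + isC (K i) * (gm - Em) <= O i.
  have := okK i; case: (K i) => [|| q r] /=; rewrite ?mul1n ?mul0n;
    [case=> -[_ HO] | case=> HO _ | case=> _ _; case: ifP => _ [_ HO]];
    by rewrite /ye in HO *; lia.
have SO_ub : SO <= (\sum_i isN (K i)) * (ze + yy) + h * (gm + Ep).
  rewrite big_distrl -[h in h * (gm + _)]card_ord -sum_nat_const -big_split.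
  exact: leq_sum.
have SO_lb : (\sum_i isN (K i)) * (ze - h) + (\sum_i isC (K i)) * (gm - Em) <= SO.
  by rewrite !big_distrl -big_split; apply: leq_sum.
have [allN|someN] := altP (@forallP _ (fun i => isN (K i))).
  exfalso.
  (* Without a lead at [ee] the sum is at most h d0 HH + HH = vv HH - HH, which is below lambda - 2
     h. *)
  have [/existsP[i0 /eqP Di0]|noE] := boolP [exists i, D i == ee]; last first.
    have : HH * SD + SO <= \sum_(i < h) (HH * d0 + (ze + yy)).
      rewrite /SD /SO big_distrr -big_split /=.
      apply: leq_sum => i _; have := okK i.
      have := allN i; case: (K i) => // _ [] [] DE OE; last first.
      - by case/existsP: noE; exists i; apply/eqP.
      - by rewrite leq_add //; [rewrite leq_mul2l; lia | lia].
      - by rewrite DE muln0; lia.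
    rewrite sum_nat_const card_ord.
    have gpHH := gp_HH.
    have EHH : HH = h * yy by [].
    have Evv := vvHH.
    have EyH : h * (HH * d0 + (ze + yy)) = h * (HH * d0) + h * ze + HH.
      by rewrite (mulnDr h (HH * d0)) (mulnDr h ze yy) addnA.
    by clearbody SD SO; clear SO_ub SO_lb O_ub O_lb; lia.
  have gt1 := gp_gt; have Eee := eeHH.
  have [/existsP[j /andP[ne_j Dj]]|others] := boolP [exists j, (j != i0) && (0 < D j)].
    (* A second positive D makes SD at least vv, while the offsets fall short of h ze by at most
       h^2. As gp > h^2 + 1, the sum exceeds lambda + 1. *)
    have : ee.+1 <= SD by rewrite /SD (bigD1 i0) //= (bigD1 j) //= Di0; lia.
    rewrite -(leq_pmul2l (_ : 0 < HH)); last by rewrite /HH /yy; lia.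
    rewrite (mulnS HH ee) (mulnC HH ee).
    have : h * (ze - h) <= SO.
      rewrite -[h in h * _]card_ord -sum_nat_const; apply: leq_sum => i _.
      by apply: leq_trans (O_lb i); rewrite (allN i) mul1n leq_addr.
    rewrite mulnBr; clearbody SD SO; clear SO_ub SO_lb O_ub O_lb; lia.
  have SDe : SD = ee.
    rewrite /SD (bigD1 i0) //= Di0 big1 ?addn0 // => i ne_i.
    apply/eqP; apply: contraR others; rewrite -lt0n => Di.
    by apply/existsP; exists i; rewrite ne_i.
  (* The sum is now at most ee HH + (h - 1) yy + ye. As [ye] is yy shortened by exactly gp + 2 h,
     this equals lambda - 2 h. *)
  have : SO + yy <= \sum_(i < h) (ze + yy) + ye.
    have Oi0 : O i0 <= ze + ye.
      have := okK i0; have := allN i0; case: (K i0) => //= _ [] []; rewrite Di0 //.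
      - by rewrite /ee; lia.
      - by rewrite /ee /d0; have := MM_gt; clear -h_gt1; nia.
      - by lia.
    rewrite /SO (bigD1 i0) //= [X in _ <= X + _](bigD1 i0) //=.
    have : \sum_(i < h | i != i0) O i <= \sum_(i < h | i != i0) (ze + yy).
      apply: leq_sum => i _; have := okK i; have := allN i.
      case: (K i) => //= _ [] [] _; last by have := ye_yy; lia.
      - by lia.
      - by lia.
    move: (\sum_(i < h | i != i0) O i) (\sum_(i < h | i != i0) (ze + yy)).
    by move=> S T; lia.
  rewrite sum_nat_const card_ord (mulnDr h ze yy) -/HH; have := ye_yy.
  rewrite SDe in sumE; rewrite (mulnC HH) in sumE.
  have gpHH := gp_HH; have EHH : HH = h * yy by [].
  by clearbody SO; clear SO_ub SO_lb O_ub O_lb; lia.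
have nNlt : \sum_i isN (K i) < h.
  move: someN; rewrite negb_forall => /existsP[i0 nNi].
  have : 0 < \sum_i isB (K i) + \sum_i isC (K i).
    rewrite -big_split /= (bigD1 i0) //=; move: nNi.
    by case: (K i0) => //=; lia.
  by lia.
have gty := yy_gt.
have ubN : (\sum_i isN (K i)) * (ze + yy) <= (h - 1) * (ze + yy).
  by rewrite leq_mul2r; apply/orP; right; lia.
have HHpos : 0 < HH by rewrite /HH /yy; lia.
have zeHH : ze + 1 < HH.
  by rewrite /HH /yy; clear -h_gt1; nia.
have SDv : SD = vv.
  apply/eqP; rewrite eqn_leq; apply/andP; split; rewrite -ltnS.
    rewrite -(ltn_pmul2l HHpos) (mulnS HH vv) (mulnC HH vv).
    by clearbody SD SO; clear SO_ub SO_lb O_ub O_lb; lia.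
  rewrite -(ltn_pmul2l HHpos) (mulnS HH SD) (mulnC HH vv).
  by clearbody SD SO; clear SO_lb O_ub O_lb; lia.
rewrite SDv (mulnC HH) in sumE.
have SO_le : SO <= ze + 1 by clearbody SO; clear SO_ub SO_lb O_ub O_lb; lia.
have gtze : 2 * h + 1 < ze by rewrite /ze /gm; clear -h_gt1; nia.
have EgE : gm - Em = 2 * h + 2 by rewrite /gm /Em; clear; lia.
(* Two normal leads bring offsets of at least 2 (ze - h), and one normal lead with one c-lead at
   least ze + h + 2; both exceed ze + 1. With a single normal lead, [fewB] supplies the c-lead. *)
case EN : (\sum_i isN (K i)) => [|[|n]].
- apply: leads_rigid okK _ SDv => i; move/eqP: EN; rewrite sum_nat_eq0 => /forallP/(_ i).
  by case: (isN _).
- have C1 : 1 <= \sum_i isC (K i) by lia.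
  have : 2 * h + 2 <= (\sum_i isC (K i)) * (gm - Em) by rewrite EgE leq_pmull.
  by move: SO_lb; rewrite EN mul1n; lia.
- have : 2 * (ze - h) <= SO.
    apply: leq_trans SO_lb; apply: leq_trans (leq_addr _ _).
    by rewrite EN leq_mul2r orbT.
  by clear -SO_le gtze h_gt1; lia.
Qed.

(** * Covering numbers by sums of leads *)

Definition TT := h.+1 * h.+1 ^ (vv * HH).

(** The ranges around d HH and ee HH begin h early because the other summands are at least 1. The
    third range stops at [ye] and the last starts at vv HH, so that h-fold sums can fail only in the
    window around lambda. *)
Definition normal_lead l : Prop :=
  [\/ 1 <= l <= yy,
      exists2 d, 1 <= d <= d0 & d * HH - h <= l <= d * HH + yy,
      ee * HH - h <= l <= ee * HH + ye | vv * HH <= l <= TT].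

Lemma split_sum n (L U : nat -> nat) s :
  (forall i, i < n -> L i <= U i) -> \sum_(i < n) L i <= s <= \sum_(i < n) U i ->
  exists2 f : nat -> nat, forall i, i < n -> L i <= f i <= U i &
    \sum_(i < n) f i = s.
Proof.
elim: n s => [|n IHn] s LU; first by rewrite !big_ord0 => ?; exists L => //; rewrite big_ord0; lia.
rewrite !big_ord_recr /= => s_bnd.
have LUn := LU n (leqnn _).
have LU' i : i < n -> L i <= U i by move=> lt_i; apply: LU; lia.
have sLU : \sum_(i < n) L i <= \sum_(i < n) U i by apply: leq_sum => i _; apply: LU'.
pose x := maxn (L n) (s - \sum_(i < n) U i).
have /andP[xP xs] : (L n <= x <= U n) && (x <= s).
  move: s_bnd sLU LUn; rewrite /x.
  by move: (\sum_(i < n) L i) (\sum_(i < n) U i) => A B; lia.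
have [||f fP sf] := IHn (s - x) => //.
  move: s_bnd sLU; rewrite /x.
  by move: (\sum_(i < n) L i) (\sum_(i < n) U i) => A B; lia.
exists (fun i => if i == n then x else f i) => [i lt_i|].
  by case: eqVneq => [->|ne_i] //; apply: fP; lia.
rewrite big_ord_recr /= eqxx (eq_bigr (fun i : 'I_n => f i)) ?sf.
  by rewrite subnK.
by move=> i _; have := ltn_ord i; case: eqP => // ->; rewrite ltnn.
Qed.

(** Slots of capacity d are filled one after another; truncated subtraction gives 0 once l is used
    up. *)
Lemma sum_minn n d l :
  \sum_(i < n) minn d (l - i * d) = minn l (n * d).
Proof.
elim: n => [|n IHn]; first by rewrite big_ord0; lia.
by rewrite big_ord_recr /= IHn mulSn; lia.
Qed.

Lemma sum_head a b : \sum_(i < h) (if i == 0 :> nat then a else b) = a + (h - 1) * b.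
Proof.
case: h h_gt1 => // n _.
by rewrite big_ord_recl /= sum_nat_const card_ord subn1.
Qed.

Lemma cover_lead l : h <= l <= TT ->
  (exists2 f : nat -> nat, forall i, i < h -> normal_lead (f i) &
     \sum_(i < h) f i = l) \/
  (exists2 e, e <= Em + Ep & l + Em = lamb + e).
Proof.
move=> /andP[h_le l_le].
have yyh : h < yy by rewrite /yy; lia.
have yypos : 0 < yy by lia.
have HHpos : h < HH by rewrite /HH; nia.
have EHH : HH = h * yy by [].
have hyy : h * yy = (h - 1) * yy + yy by rewrite -mulSnr; congr (_ * _); lia.
have Eye := ye_yy; have Eee := eeHH; have gpvv := gp_vvHH; have gpHH := gp_HH.
have head L0 U0 : L0 <= U0 ->
  (forall x, L0 <= x <= U0 -> normal_lead x) ->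
  L0 + (h - 1) <= l <= U0 + (h - 1) * yy ->
  exists2 f : nat -> nat, forall i, i < h -> normal_lead (f i) & \sum_(i < h) f i = l.
  move=> LU0 N0 l_bnd.
  have [|| f fP sf] := @split_sum h (fun i => if i == 0 then L0 else 1)
    (fun i => if i == 0 then U0 else yy) l.
  - by move=> i _; case: ifP.
  - by rewrite !sum_head muln1.
  exists f => // i /fP; case: ifP => _; first exact: N0.
  by move=> fi; apply: Or41.
have [lt_l|ge_l] := ltnP l HH.
  left; apply: (head 1 yy) => //; first by move=> x xP; apply: Or41.
  by lia.
have [lt_l2|ge_l2] := ltnP l (ee * HH).
  left; pose q := l %/ HH.
  have q_gt0 : 0 < q by rewrite divn_gt0; lia.
  have q_le : q <= h * d0 by rewrite /q -ltnS ltn_divLR; rewrite /ee addn1 in lt_l2 *; lia.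
  have Eq : l = q * HH + l %% HH by apply: divn_eq.
  have lt_r : l %% HH < HH by rewrite ltn_mod; lia.
  pose d i := minn d0 (q - i * d0).
  have sd : \sum_(i < h) d i = q by rewrite sum_minn; lia.
  (* A slot with d i = 0 costs at least 1. Slot 0 has d 0 > 0, and the h by which its range starts
     early pays for all of these. *)
  pose L i := if d i == 0 then 1 else d i * HH - h.
  have dHH i : 0 < d i -> HH <= d i * HH by move=> di; rewrite leq_pmull.
  have [|| f fP sf] := @split_sum h L (fun i => d i * HH + yy) l.
  - move=> i _; rewrite /L; case: eqVneq => [->|di]; lia.
  - rewrite big_split /= sum_nat_const card_ord -big_distrl /= sd -EHH.
    apply/andP; split; last by rewrite {1}Eq leq_add2l ltnW.
    rewrite -(leq_add2r h); apply: (@leq_trans (q * HH + h)); last first.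
      by rewrite leq_add2r {1}Eq leq_addr.
    have Eh : \sum_(i < h) (if i == 0 :> nat then h else 0) = h.
      by rewrite sum_head muln0 addn0.
    have Eh1 : \sum_(i < h) 1 = h by rewrite sum_nat_const card_ord muln1.
    have : \sum_(i < h) (L i + (if i == 0 :> nat then h else 0)) <=
           \sum_(i < h) (d i * HH + 1).
      apply: leq_sum => i _.
      have := dHH i; rewrite /L; case: (eqVneq (nat_of_ord i) 0) => [->|_].
        have di : 0 < d 0 by rewrite /d /d0; have := MM_gt; lia.
        have -> : (d 0 == 0) = false by apply/negbTE; rewrite -lt0n.
        by move=> /(_ di); lia.
      by case: eqVneq => [->|di]; lia.
    by rewrite !big_split /= Eh Eh1 -big_distrl /= sd.
  exists f => // i /fP; rewrite /L; case: eqVneq => [->|di] fi.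
    by apply: Or41; lia.
  by apply: Or42; exists (d i) => //; rewrite /d in di *; lia.
have [lt_l3|ge_l3] := leqP l (ee * HH + ye + (h - 1) * yy).
  left; apply: (head (ee * HH - h) (ee * HH + ye)) => //; first by lia.
    by move=> x xP; apply: Or43.
  by lia.
have [lt_l4|ge_l4] := ltnP l (vv * HH + h); last first.
  left; apply: (head (l - (h - 1)) (l - (h - 1))) => //.
    by move=> x xP; apply: Or44; lia.
  by have : (h - 1) * 1 <= (h - 1) * yy; [rewrite leq_mul2l yypos orbT | lia].
(* Here l lies above ee HH + ye + (h - 1) yy = lambda - Em and below vv HH + h = lambda + Ep. *)
right; exists (l + Em - lamb).
  by rewrite /Em /Ep /lamb; lia.
by rewrite /lamb /Em; lia.
Qed.

Lemma vvHH_TT : vv * HH < h.+1 ^ (vv * HH).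
Proof. by rewrite ltn_expl // ltnS ltnW. Qed.

Lemma TT_ge : vv * HH <= TT.
Proof. exact: leq_trans (ltnW vvHH_TT) (leq_pmull _ _). Qed.

Lemma normal_lead_bnd l : normal_lead l -> 0 < l <= TT.
Proof.
have T := TT_ge; have E := eeHH; have V := vvHH; have Y := ye_yy.
have yyHH : yy <= HH by rewrite /HH leq_pmull // ltnW.
have gtH : h < HH by rewrite /HH /yy; clear -h_gt1; nia.
have ee_gt : 0 < ee by rewrite /ee addn1.
have HHle d : 0 < d -> HH <= d * HH by move=> ?; rewrite leq_pmull.
have eeH := HHle _ ee_gt.
case=> [lP|[d /andP[d_gt d_le] lP]|lP|lP].
- by lia.
- have := HHle _ d_gt; have : d * HH <= h * (HH * d0); last by lia.
  by rewrite (mulnC HH) mulnA leq_mul2r (leq_trans d_le) ?orbT // leq_pmull // ltnW.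
- by lia.
- by lia.
Qed.

Lemma lead_bnd K D O l : ~~ isN K -> lead_ok K D O -> l + ze = D * HH + O ->
  0 < l <= TT.
Proof.
move=> notN okK El.
have T := TT_ge; have V := vv_gt; have M := MM_gt.
have zeHH : ze + gm + Ep < HH by rewrite /HH /yy; clear -h_gt1; nia.
have hMM : h <= h * MM by rewrite leq_pmulr //; lia.
suff [D1 [lt_D|[le_D O0]]] : 0 < D /\ (D < vv /\ O <= gm + Ep \/ D <= vv /\ O = 0).
- case: lt_D => lt_D O_le; have : HH <= D * HH by rewrite leq_pmull.
  have : D.+1 * HH <= vv * HH by rewrite leq_mul2r lt_D orbT.
  by rewrite mulSn; lia.
- have : HH <= D * HH by rewrite leq_pmull.
  have : D * HH <= vv * HH by rewrite leq_mul2r le_D orbT.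
  by lia.
case: K notN okK => // [|q r] _ /= => [[O0 DE]|[lt_q lt_r]].
  by case: DE => ->; lia.
have MMle : MM <= h * MM by rewrite leq_pmull // ltnW.
case: ifP => [_ [-> /andP[_ O_le]]|_ [-> O_le]]; last first.
  by have := cd_le lt_q lt_r; lia.
have Sle := sum_cd_le lt_q.
suff S0 : 0 < \sum_(r < h | r != q :> nat) cd q r by rewrite /cbig; lia.
have [r' ne_r'] : exists r' : 'I_h, r' != q :> nat.
  case: (posnP q) => [->|q_gt]; first by exists (Ordinal h_gt1).
  by exists (Ordinal (ltnW h_gt1)) => /=; lia.
by rewrite (bigD1 r') //= addn_gt0; have /andP[-> _] := cd_le lt_q (ltn_ord r').
Qed.

(** Keeps the subtraction of [ze] from truncating when a lead is recovered from D and O. *)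
Lemma lead_pos K D O : ~~ isN K -> lead_ok K D O -> ze <= D * HH + O.
Proof.
move=> notN okK; suff D1 : 0 < D.
  have : ze <= HH by rewrite /HH /yy; clear -h_gt1; nia.
  by have := leq_pmull HH D1; lia.
have V := vv_gt; have M := MM_gt; have hMM : h <= h * MM by rewrite leq_pmulr //; lia.
case: K notN okK => // [|q r] _ /= => [[_ [->|->]]|[lt_q lt_r]]; [done | by lia | ].
case: ifP => _ [-> _]; last by rewrite expn_gt0.
by have := sum_cd_le lt_q; rewrite /cbig; lia.
Qed.

(** All roles but q have offset gm, so the offset of q alone moves the sum through the window;
    lambda itself corresponds to the offset gm. *)
Lemma sum_leads (q : 'I_h) (D O l : 'I_h -> nat) :
  (forall r : 'I_h, lead_ok (KC q r) (D r) (O r)) ->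
  (forall r, l r + ze = D r * HH + O r) -> \sum_r l r + gm = lamb + O q.
Proof.
move=> okK El; have : \sum_r (l r + ze) = \sum_r (D r * HH + O r) by apply: eq_bigr.
rewrite !big_split /= sum_nat_const card_ord -big_distrl /=.
have -> : \sum_r D r = vv.
  rewrite (bigD1 q) //=; have := okK q; rewrite /= eqxx => -[_ _ [-> _]].
  rewrite (eq_bigr (fun r : 'I_h => cd q r)) => [|r ne_r].
    by rewrite subnK //; have := sum_cd_le (ltn_ord q); have := vv_gt; lia.
  have := okK r; rewrite /=; case: eqP => [qr|_ [_ _ []] //].
  by case/eqP: ne_r; apply: val_inj.
have -> : \sum_r O r = O q + (h - 1) * gm.
  rewrite (bigD1 q) //=; congr (_ + _).
  rewrite (eq_bigr (fun=> gm)) ?sum_nat_const ?cardC1 ?card_ord ?subn1 // => r ne_r.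
  have := okK r; rewrite /=; case: eqP => [qr|_ [_ _ []] //].
  by case/eqP: ne_r; apply: val_inj.
have Egm : gm + (h - 1) * gm = ze.
  by rewrite -mulSn /ze; congr (_ * _); lia.
by have := ze_gp; have := gp_vvHH; rewrite /lamb; lia.
Qed.

Lemma sum_last (F : nat -> nat) c :
  \sum_(i < h) (if i < h - 1 then F i else c) = \sum_(i < h - 1) F i + c.
Proof.
case: h h_gt1 => // n _; rewrite subn1 /= big_ord_recr /= ltnn; congr (_ + _).
by apply: eq_bigr => i _; rewrite ltn_ord.
Qed.

End Leads.

(** * The basis *)

Section Stages.
Variable h : nat.
Hypothesis h_gt1 : 1 < h.
Variables (extra : pred nat) (wown : nat -> nat) (K : nat).
Hypothesis wown_lt : forall w, ~~ extra w -> wown w < h - 1.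
Hypothesis extraS : forall w, extra w -> ~~ extra w.+1.

Local Notation g := h.+1.
Definition Dl := vv h * HH h.
Hypothesis K_gt : 2 * Dl + 6 <= K.

Let g_gt1 : 1 < g. Proof. by rewrite ltnS ltnW. Qed.
Let g_gt0 : 0 < g. Proof. by []. Qed.
Let gX_gt0 k : 0 < g ^ k. Proof. by rewrite expn_gt0. Qed.

(* Block t occupies the positions from sp t to wp t.  Its two ends carry markers which
   keep A away from the multiples of g ^ mp t (lemma isolated), mp t being where the
   special tails of type t start to be free. *)
Definition sp t := K * (t.+1 * t.+1).
Definition wp t := sp t + t + 3 + extra (sp t + t + 3).
Definition mp t := wp t + 1 + 2 * Dl.

Lemma wp_bnd t : sp t + t + 3 <= wp t <= sp t + t + 4.
Proof. by rewrite /wp; case: extra; lia. Qed.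

Lemma extra_wp t : ~~ extra (wp t).
Proof.
by rewrite /wp; case E: (extra (sp t + t + 3)); [rewrite /= addn1 extraS | rewrite addn0 E].
Qed.

Lemma mp_sp t t' : t < t' -> mp t <= sp t'.
Proof.
move=> lt_t; have := wp_bnd t; rewrite /mp => /andP[_ wp_le].
have : sp t.+1 <= sp t' by rewrite leq_mul2l leq_mul ?orbT.
have : sp t.+1 = sp t + K * (2 * t + 3) by rewrite /sp; lia.
have : (2 * Dl + 6) * (2 * t + 3) <= K * (2 * t + 3) by rewrite leq_mul2r K_gt orbT.
nia.
Qed.

Lemma sp_gt t : t < sp t. Proof. by rewrite /sp; nia. Qed.

Lemma wp_gt t : t < wp t. Proof. by have := sp_gt t; have := wp_bnd t; lia. Qed.

Definition inblk w := has (fun t => sp t <= w < wp t) (iota 0 w.+1).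
Definition si w := has (fun t => w == sp t) (iota 0 w.+1).
Definition wi w := has (fun t => w == wp t) (iota 0 w.+1).
(* Role 0 owns the extra positions and the blocks, the roles 1, ..., h - 1 share the others;
   the b-elements 0, ..., h - 2 share all nonextra positions ([wown_is]). *)
Definition own w := if extra w || inblk w then 0 else (wown w).+1.

Lemma inblkP w : reflect (exists t, sp t <= w < wp t) (inblk w).
Proof.
apply: (iffP hasP) => [[t _ wt]|[t wt]]; exists t => //.
by rewrite mem_iota; have := sp_gt t; lia.
Qed.

Lemma siP w : reflect (exists t, w = sp t) (si w).
Proof.
apply: (iffP hasP) => [[t _ /eqP wt]|[t wt]]; exists t; rewrite ?wt //.
by rewrite mem_iota; have := sp_gt t; lia.
Qed.

Lemma wiP w : reflect (exists t, w = wp t) (wi w).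
Proof.
apply: (iffP hasP) => [[t _ /eqP wt]|[t wt]]; exists t; rewrite ?wt //.
by rewrite mem_iota; have := wp_gt t; lia.
Qed.

Lemma own_lt w : own w < h.
Proof.
rewrite /own; case: ifP => [_|/negbT]; first exact: ltnW.
by rewrite negb_or => /andP[/wown_lt]; lia.
Qed.

Lemma si_own w : si w -> own w = 0.
Proof.
move=> /siP[t ->]; rewrite /own; suff -> : inblk (sp t) by rewrite orbT.
by apply/inblkP; exists t; have := wp_bnd t; lia.
Qed.

(** Block t ends just before wp t, other blocks are far away by [mp_sp], and wp t was shifted off
    the extra positions. *)
Lemma wi_own w : wi w -> own w != 0.
Proof.
move=> /wiP[t ->]; rewrite /own (negbTE (extra_wp t)) /=.
case: (boolP (inblk (wp t))) => [/inblkP[t' wt']|//].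
case: (ltngtP t t') => [lt_t|lt_t|Et]; last by move: wt'; rewrite Et; lia.
  by have := mp_sp lt_t; rewrite /mp; lia.
by have := mp_sp lt_t; have := wp_bnd t; rewrite /mp; lia.
Qed.

Lemma si_wi w : si w -> wi w = false.
Proof. by move=> /si_own w0; apply: contraTF isT => /wi_own; rewrite w0. Qed.

Lemma siwi_gap t w : sp t < w < wp t -> si w = false /\ wi w = false.
Proof.
move=> w_bnd.
have own0 : own w = 0.
  rewrite /own; suff -> : inblk w by rewrite orbT.
  by apply/inblkP; exists t; lia.
split; last by apply: contraTF isT => /wi_own; rewrite own0.
apply: contraTF isT => /siP[t' Ew].
case: (ltngtP t t') => [lt_t|lt_t|Et]; last by move: w_bnd; rewrite Ew Et; lia.
  by have := mp_sp lt_t; rewrite /mp; lia.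
by have := mp_sp lt_t; have := wp_bnd t'; rewrite /mp; lia.
Qed.

(* With ty, each a is the type of the stages 2^a (2j + 1) - 1. *)
Definition kk s := Dl * s.
Definition ty s := logn 2 s.+1.

(* Marker digits: over all roles, and over h - 1 b-elements, they add up to the same
   h - 1 at both ends of each block. *)
Definition cdig r w : nat := if r == 0 then (h - 1) * wi w else si w.
Definition bdig w : nat := si w + wi w.

Definition dig (V : pred nat) (d : nat -> nat) :=
  (forall w, d w < g) /\ (forall w, ~~ V w -> d w = 0).

Definition own_is r : pred nat := fun w => own w == r.
Definition wown_is t m : pred nat := fun w => [&& ~~ extra w, wown w == t & m <= w].

(* A digit below g - 1 inside the block stops carries, so that the marker at sp t
   survives. *)
Definition gaps m k (d : nat -> nat) :=
  forall t, m <= sp t -> wp t < k -> exists2 p, sp t < p < wp t & d p < h.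

(* The special tails of type a. *)
Definition pat a k (d : nat -> nat) :=
  [/\ forall w, w < mp a -> d w = digit g a w,
      forall w, mp a <= w < k -> extra w -> d w = 0 & gaps (mp a) k d].

Definition bad q a k d := forall d', (forall w, d' w < g) ->
  (forall w, w < k -> own w = q -> d' w = d w) -> ~ pat a k d'.

Definition elt k l (e d : nat -> nat) := l * g ^ k + num g k (fun w => e w + d w).

Definition normal_elt s x := exists r l d,
  [/\ r < h, normal_lead h l, dig (own_is r) d & x = elt (kk s) l (cdig r) d].

Definition c_elt (flag : Prop) s x := exists q r D O, exists l d,
  [/\ lead_ok h (KC q r) D O, l + ze h = D * HH h + O, dig (own_is r) d,
      q = r -> O = gm h -> flag -> bad q (ty s) (kk s) d &
      x = elt (kk s) l (cdig r) d].

(** One large b-lead and h - 2 b-leads with D = 1 bring the total D to vv. *)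
Definition blead t := if t == 0 then vv h - (h - 2) else 1.

Definition b_elt s x := exists t l d,
  [/\ t < h - 1, l + ze h = blead t * HH h, dig (wown_is t (mp (ty s))) d,
      gaps (mp (ty s)) (kk s) d & x = elt (kk s) l bdig d].

Definition stage flag s x := [\/ normal_elt s x, c_elt flag s x | b_elt s x].

(* Family members are excluded in stage s only if ty s already belongs to A. *)
Fixpoint As s : nat -> Prop := if s is s'.+1 then fun x =>
    As s' x \/ stage (As s' (ty s') /\ mp (ty s') <= kk s') s' x
  else fun=> False.

Definition AA x := exists s, As s x.
Definition flag s := As s (ty s) /\ mp (ty s) <= kk s.

Lemma AsP s x : As s x <-> exists2 s', s' < s & stage (flag s') s' x.
Proof.
elim: s => [|s IHs] /=; first by split=> // -[].
split=> [[/IHs[s' lt_s' sx]|sx]|[s' lt_s' sx]].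
- by exists s' => //; apply: ltnW.
- by exists s.
- move: lt_s'; rewrite ltnS leq_eqVlt => /predU1P[<-|lt_s']; first by right.
  by left; apply/IHs; exists s'.
Qed.

Lemma AAP x : AA x <-> exists s, stage (flag s) s x.
Proof.
split=> [[s /AsP[s' _ sx]]|[s sx]]; first by exists s'.
by exists s.+1; apply/AsP; exists s.
Qed.

(** A role has markers only at positions owned by others: role 0 at the wp t, the other roles at the
    sp t, which role 0 owns. *)
Lemma cdig_lt r d w : dig (own_is r) d -> cdig r w + d w < g.
Proof.
move=> [d_lt d0]; rewrite /cdig; have := d_lt w.
case: eqVneq => [Er|ne_r].
  case wiw: (wi w); last by rewrite muln0.
  by rewrite (d0 w) ?muln1 ?addn0; [lia | rewrite /own_is Er; apply: wi_own].
case siw: (si w) => //; rewrite (d0 w) // /own_is (si_own siw).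
by rewrite eq_sym.
Qed.

Lemma bdig_le w : bdig w <= 1.
Proof. by rewrite /bdig; case siw: (si w); rewrite ?(si_wi siw) //; case: (wi w). Qed.

Lemma cdig_le r w : cdig r w <= h - 1.
Proof. by rewrite /cdig; case: eqP => _; [case: (wi w)|case: (si w)]; lia. Qed.

(** * Size and isolation of the elements *)

Lemma elt_bnd k l e d : (forall w, e w < g) -> (forall w, d w < g) ->
  l * g ^ k <= elt k l e d < (l + 2) * g ^ k.
Proof.
move=> e_lt d_lt; rewrite /elt numD leq_addr /= mulnDl.
have := ltn_num g_gt1 (k := k) (fun w _ => e_lt w).
by have := ltn_num g_gt1 (k := k) (fun w _ => d_lt w); lia.
Qed.

Lemma stage_elt fl s x : stage fl s x -> exists l e d,
  [/\ 0 < l <= TT h, forall w, e w < g, forall w, d w < g & x = elt (kk s) l e d].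
Proof.
have cd_lt r w : cdig r w < g by have := cdig_le r w; lia.
case=> [[r [l [d [lt_r nl [d_lt _] ->]]]]|[q [r [D [O [l [d [ok El [d_lt _] _ ->]]]]]]]|].
- by exists l, (cdig r), d; split=> //; apply: normal_lead_bnd.
- by exists l, (cdig r), d; split=> //; apply: lead_bnd ok El.
case=> t [l [d [lt_t El [d_lt _] _ ->]]].
exists l, bdig, d; split=> // [|w]; last by rewrite ltnS (leq_trans (bdig_le _)) // ltnW.
apply: (@lead_bnd _ h_gt1 KB (blead t) 0) => //=; last by rewrite addn0.
by rewrite /blead; case: eqP; split=> //; [right|left].
Qed.

Lemma stage_bnd fl s x : stage fl s x -> g ^ kk s <= x < (TT h + 2) * g ^ kk s.
Proof.
move=> /stage_elt[l [e [d [l_bnd e_lt d_lt ->]]]].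
have /andP[lb ub] := elt_bnd (kk s) l e_lt d_lt.
rewrite (leq_trans _ lb) /=; last by rewrite leq_pmull //; lia.
by apply: leq_trans ub _; rewrite leq_mul2r; lia.
Qed.

Lemma Dl_gt : h < Dl.
Proof.
have := gp_HH h_gt1; have := vv_gt h_gt1; have := MM_gt h_gt1; rewrite /Dl.
move: (vv h) (HH h) => V H; nia.
Qed.

Lemma TT2_le : TT h + 2 <= (h + 2) * g ^ Dl.
Proof.
have : 2 <= g ^ Dl by apply: leq_trans (ltn_expl _ g_gt1); have := Dl_gt; lia.
by rewrite /TT -/Dl; move: (g ^ Dl) => X X_ge; nia.
Qed.

Lemma TT2_ltX k : (TT h + 2) * g ^ k <= g ^ (k + 2 * Dl).
Proof.
rewrite mulnC expnD leq_mul2l; apply/orP; right.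
apply: leq_trans TT2_le _; rewrite mul2n -addnn expnD leq_mul2r.
by have := ltn_expl Dl g_gt1; have := Dl_gt; lia.
Qed.

Lemma digit_elt k l e d w : (forall w, e w + d w < g) -> w < k ->
  digit g (elt k l e d) w = e w + d w.
Proof. by move=> ed_lt lt_wk; rewrite /elt digit_num. Qed.

Lemma stage_isolated fl s t x : stage fl s x -> wp t < kk s ->
  g ^ sp t <= x %% g ^ (wp t).+1.
Proof.
move=> sx lt_t; have wpt := wp_bnd t.
have c_case r l d : dig (own_is r) d ->
    g ^ sp t <= elt (kk s) l (cdig r) d %% g ^ (wp t).+1.
  move=> dP; have cd_lt w := cdig_lt w dP.
  (* Role 0 shows its marker at wp t, every other role at sp t. *)
  have [Er|ne_r] := eqVneq r 0; last first.
    apply: leq_modn_digit => //; first by lia.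
    rewrite digit_elt //; last by lia.
    have -> : cdig r (sp t) = 1 by rewrite /cdig (negbTE ne_r); case: siP => // -[]; exists t.
    by [].
  apply: leq_trans (leq_modn_digit g_gt1 (ltnSn (wp t)) _).
    by rewrite leq_exp2l //; lia.
  rewrite digit_elt // Er /cdig eqxx.
  by case: wiP => [_|[]]; [rewrite muln1; lia | exists t].
case: sx => [[r [l [d [lt_r nl dP ->]]]]|[q [r [D [O [l [d [ok El dP _ ->]]]]]]]|].
- exact: c_case.
- exact: c_case.
case=> t' [l [d [lt_t' El [d_lt d0] dgap ->]]]; set m := mp _ in d0 dgap.
have b_lt w : bdig w < g by rewrite ltnS (leq_trans (bdig_le _)) // ltnW.
have bsp : bdig (sp t) = 1.
  have sis : si (sp t) by apply/siP; exists t.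
  by rewrite /bdig sis (si_wi sis).
(* If the free digits reach the block, adding the marker may carry, and the digit at p given by
   [gaps] stops the carry before wp t. Otherwise the block lies below m, where a b-element has only
   markers. *)
have [le_m|lt_m] := leqP m (sp t).
  apply: leq_trans (leq_modn_exp _ _ (leqnSn _)).
  have [p p_bnd dp] := dgap t le_m lt_t.
  have Eb : num g (wp t) bdig = num g (sp t).+1 bdig.
    apply: num_tail => [|w w_bnd]; first by lia.
    by have [] := @siwi_gap t w _; [lia | rewrite /bdig => -> ->].
  have b_ub : num g (wp t) bdig < g ^ p.
    rewrite Eb; apply: leq_trans (ltn_num g_gt1 (fun w _ => b_lt w)) _.
    by rewrite leq_exp2l //; lia.
  have d_ub : num g (wp t) d + g ^ p < g ^ wp t.
    by apply: num_digit_gap => //; lia.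
  have [j Ej] := num_ext g_gt1 (fun w => bdig w + d w) (ltnW lt_t).
  rewrite /elt Ej addnA -(subnK (ltnW lt_t)) expnD mulnA -mulnDl modnMDl.
  rewrite numD modn_small; last by lia.
  apply: leq_trans (leq_addr _ _); apply: leq_exp_num; rewrite ?bsp //; lia.
have lt_wm : (wp t).+1 <= m.
  move: lt_m; rewrite /m; case: (ltngtP t (ty s)) => [lt_tt|lt_tt|->].
  - by have := mp_sp lt_tt; have := wp_bnd (ty s); rewrite /mp; lia.
  - by have := mp_sp lt_tt; lia.
  - by rewrite /mp; lia.
apply: leq_modn_digit => //; first by lia.
have E w : w < (wp t).+1 -> d w = 0.
  by move=> lt_w; apply: d0; rewrite /wown_is; lia.
have ed_lt w : w < (wp t).+1 -> bdig w + d w < g by move=> /E->; rewrite addn0.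
have lt_sw : sp t < (wp t).+1 by lia.
rewrite -(digit_modn g_gt1 _ lt_sw) /elt modn_num //.
by rewrite -[num _ _ _]add0n -(mul0n (g ^ (wp t).+1)) digit_num // bsp.
Qed.

(** A stage too low to contain block t has only elements below g ^ mp t, which is why mp t exceeds
    wp t by more than 2 Dl. *)
Lemma isolated t x : AA x -> g ^ mp t <= x -> g ^ sp t <= x %% g ^ mp t.
Proof.
move=> /AAP[s sx] le_x.
have [lt_t|le_t] := ltnP (wp t) (kk s).
  apply: leq_trans (stage_isolated sx lt_t) _.
  by apply: leq_modn_exp => //; rewrite /mp; lia.
have /andP[_ x_lt] := stage_bnd sx.
have := leq_trans x_lt (TT2_ltX _); rewrite ltnNge.
by rewrite (leq_trans _ le_x) // leq_exp2l // /mp; lia.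
Qed.

(** The number a is below g ^ sp a, and by [isolated] no element from g ^ mp a on has so small a
    residue. *)
Lemma AA_mod_inj a x : AA x -> x = a %[mod g ^ mp a] -> x = a.
Proof.
move=> Ax; have a_lt : a < g ^ sp a.
  by apply: leq_trans (ltn_expl a g_gt1) _; rewrite leq_exp2l // ltnW // sp_gt.
have a_lt' : a < g ^ mp a.
  apply: leq_trans a_lt _; rewrite leq_exp2l // /mp.
  by have := wp_bnd a; lia.
rewrite [a %% _]modn_small //.
have [x_lt|/(isolated Ax) le_x] := ltnP x (g ^ mp a); first by rewrite modn_small.
by move=> Ex; move: le_x; rewrite Ex leqNgt a_lt.
Qed.

(** * Representations of the special numbers *)

Definition shape (s : nat) (k : kind) O l x : Prop := match k with
  | KN => True
  | KB => x = num g (mp (ty s)) bdig %[mod g ^ mp (ty s)]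
  | KC q r => exists d, [/\ dig (own_is r) d,
      q = r -> O = gm h -> bad q (ty s) (kk s) d & x = elt (kk s) l (cdig r) d]
  end.

(* Stages after s are too large to contribute, and the earlier ones have D = 0. *)
Lemma classify s x : flag s -> AA x -> x < vv h * HH h * g ^ kk s ->
  exists k D O l, [/\ lead_ok h k D O, l + ze h = D * HH h + O,
    l * g ^ kk s <= x < (l + 2) * g ^ kk s & shape s k O l x].
Proof.
move=> fs /AAP[s' sx] x_lt; have [_ le_m] := fs.
have XS j : j < s' -> g ^ Dl * g ^ kk j <= g ^ kk s'.
  by move=> lt_j; rewrite -expnD leq_exp2l // /kk -mulnS leq_mul2l lt_j orbT.
have cd_lt r w : cdig r w < g by have := cdig_le r w; lia.
have bd_lt w : bdig w < g by rewrite ltnS (leq_trans (bdig_le _)) // ltnW.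
case: (ltngtP s s') => [lt_s|lt_s|Es].
- have /andP[x_ge _] := stage_bnd sx.
  have := leq_trans (XS _ lt_s) x_ge; rewrite leqNgt (leq_trans x_lt) //.
  by rewrite leq_mul2r ltnW ?orbT //; apply: vvHH_TT.
- pose l := x %/ g ^ kk s.
  have Ex : x = l * g ^ kk s + x %% g ^ kk s := divn_eq _ _.
  have r_lt : x %% g ^ kk s < g ^ kk s by rewrite ltn_mod.
  have l_le : l <= yy h.
    rewrite -ltnS ltn_divLR //; have /andP[_ /leq_trans] := stage_bnd sx; apply.
    have : g ^ Dl * g ^ kk s' <= g ^ kk s.
      by rewrite -expnD leq_exp2l // /kk -mulnS leq_mul2l lt_s orbT.
    have := TT2_le; have : h + 2 <= yy h by rewrite /yy; clear; nia.
    move: (g ^ Dl) (g ^ kk s') (g ^ kk s) (TT h) (yy h) => A B C T Y le_Y le_T le_C.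
    apply: (@leq_trans ((h + 2) * A * B)); first by rewrite leq_mul2r le_T orbT.
    by rewrite -mulnA leq_mul //; lia.
  (* The quotient l of an element of an earlier stage can be 0, so O starts at ze when D = 0. *)
  exists KN, 0, (ze h + l), l; split=> //.
  + by apply: Or31; split=> //; lia.
  + by rewrite mul0n addnC.
  + by rewrite mulnDl {1}Ex {2}Ex; lia.
subst s'; case: sx => [[r [l [d [lt_r nl dP Ex]]]]|[q [r [D [O [l [d [ok El dP bad_d Ex]]]]]]]|].
- have [d_lt _] := dP; have x_bnd := elt_bnd (kk s) l (cd_lt r) d_lt; rewrite -Ex in x_bnd.
  have HHh : h <= HH h by rewrite /HH leq_pmulr // /yy addn2.
  case: nl => [lP|[D /andP[D_gt D_le] lP]|lP|lP].
  + exists KN, 0, (ze h + l), l; split=> //; last by rewrite mul0n addnC.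
    by apply: Or31; split=> //; lia.
  + have DH : HH h <= D * HH h by rewrite leq_pmull.
    have zeh : h <= ze h by rewrite /ze leq_pmulr // /gm addn2.
    exists KN, D, (l + ze h - D * HH h), l; split=> //; last by lia.
    by apply: Or32; split; [rewrite D_gt | lia].
  + have eeH : HH h <= ee h * HH h by rewrite leq_pmull // /ee addn1.
    have zeh : h <= ze h by rewrite /ze leq_pmulr // /gm addn2.
    exists KN, (ee h), (l + ze h - ee h * HH h), l; split=> //; last by lia.
    by apply: Or33; split; lia.
  + move: x_lt; rewrite ltnNge; case/negP; case/andP: x_bnd => x_ge _.
    by apply: leq_trans x_ge; rewrite leq_mul2r; lia.
- exists (KC q r), D, O, l; split=> //.
    by rewrite Ex; apply: elt_bnd => //; case: dP.
  by exists d; split=> // qr OE; apply: bad_d.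
case=> t [l [d [lt_t El [d_lt d0] dgap Ex]]].
exists KB, (blead t), 0, l; split=> //; rewrite ?addn0 //.
- by split=> //; rewrite /blead; case: eqP; [right|left].
- by rewrite Ex; apply: elt_bnd.
rewrite /= Ex /elt modn_num //.
  rewrite modn_small; last by apply: ltn_num.
  by apply: eq_num => w lt_w; rewrite d0 ?addn0 // /wown_is; lia.
by move=> w lt_w; rewrite d0 ?addn0 // /wown_is; lia.
Qed.

Lemma num_modX j k e : j <= k -> num g k e = num g j e %[mod g ^ j].
Proof. by move=> le_jk; have [q ->] := num_ext g_gt1 e le_jk; rewrite modnMDl. Qed.

(** Lead lambda together with the sum of all markers, which is the same for a c-family as for h - 1
    b-elements. *)
Definition base s := lamb h * g ^ kk s + (h - 1) * num g (kk s) bdig.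

Lemma Zb_lt k : (h - 1) * num g k bdig < g ^ k.
Proof.
rewrite -numZ; apply: ltn_num => // w _.
by rewrite (leq_ltn_trans (leq_mul (leqnn _) (bdig_le w))) // muln1; lia.
Qed.

Lemma base_lt s y : y < g ^ kk s -> base s + y < Dl * g ^ kk s.
Proof.
move=> y_lt; have Zlt := Zb_lt (kk s).
apply: (@leq_trans ((lamb h + 2) * g ^ kk s)); first by rewrite mulnDl /base; lia.
by rewrite leq_mul2r lamb_le ?orbT.
Qed.

Lemma sum_isB (k : 'I_h -> kind) : h - 2 < \sum_i isB (k i) ->
  exists i0, forall i, i != i0 -> isB (k i).
Proof.
move=> manyB.
have i00 : 'I_h by exists 0; lia.
have [allB|/forallPn[i0 nB0]] := boolP [forall i, isB (k i)].
  by exists i00 => i _; apply: (forallP allB).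
exists i0 => i ne_i; apply: contraLR manyB => nBi; rewrite -leqNgt.
have sumh : \sum_i isB (k i) + \sum_i ~~ isB (k i) = h.
  rewrite -big_split -[RHS]card_ord -sum1_card; apply: eq_bigr => j _ /=.
  by case: (isB _).
have : 1 < \sum_i ~~ isB (k i).
  by rewrite (bigD1 i0) // (bigD1 i) //= nB0 nBi.
by move: sumh; move: (\sum_i isB (k i)) (\sum_i ~~ isB (k i)) => A B; lia.
Qed.

Lemma role_sum k (l : 'I_h -> nat) (dr : 'I_h -> nat -> nat) :
  \sum_(r < h) elt k (l r) (cdig r) (dr r) = (\sum_r l r) * g ^ k +
    (h - 1) * num g k bdig + num g k (fun w => \sum_r dr r w).
Proof.
rewrite big_split -big_distrl /= -addnA; congr (_ + _).
rewrite -num_sum -numZ -numD; apply: eq_num => w _.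
rewrite big_split; congr (_ + _).
have := sum_head h_gt1 ((h - 1) * wi w) (si w); rewrite /cdig => ->.
by rewrite mulnDr addnC.
Qed.

(** By [window_sum_forced] there are two cases. With h - 1 b-elements, residues leave only a for the
    last summand; a full c-family is impossible, as its role q would repeat the q-digits of a
    special tail. *)
Lemma rep_uses_type s d (rep : 'I_h -> nat) : flag s -> (forall w, d w < g) ->
  pat (ty s) (kk s) d -> (forall i, AA (rep i)) ->
  \sum_i rep i = base s + num g (kk s) d -> exists i, rep i = ty s.
Proof.
move=> fs d_lt pd repA sum_rep.
have [As_a le_m] := fs; have Zlt := Zb_lt (kk s).
have num_d := ltn_num g_gt1 (k := kk s) (fun w _ => d_lt w).
have gtgp := gp_gt h_gt1; have gple := gp_vvHH h_gt1.
have n_lt : base s + num g (kk s) d < (lamb h + 2) * g ^ kk s.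
  by rewrite mulnDl /base; lia.
have rep_lt i : rep i < vv h * HH h * g ^ kk s.
  apply: leq_ltn_trans (_ : _ <= \sum_i rep i) _.
    by rewrite (bigD1 i) //= leq_addr.
  rewrite sum_rep; apply: leq_trans n_lt _; rewrite leq_mul2r /lamb; lia.
have /fin_all_exists[f fP] i : exists p : kind * nat * nat * nat,
    [/\ lead_ok h p.1.1.1 p.1.1.2 p.1.2, p.2 + ze h = p.1.1.2 * HH h + p.1.2,
     p.2 * g ^ kk s <= rep i < (p.2 + 2) * g ^ kk s & shape s p.1.1.1 p.1.2 p.2 (rep i)].
  by have [k [D [O [l kP]]]] := classify fs (repA i) (rep_lt i); exists (k, D, O, l).
pose k i := (f i).1.1.1; pose D i := (f i).1.1.2; pose O i := (f i).1.2.
pose l i := (f i).2.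
have okk i : lead_ok h (k i) (D i) (O i) by case: (fP i).
have El i : l i + ze h = D i * HH h + O i by case: (fP i).
have lo : lamb h < \sum_i l i + 2 * h.
  rewrite -(ltn_pmul2r (gX_gt0 (kk s))).
  apply: (@leq_ltn_trans (\sum_i rep i)); first by rewrite sum_rep /base -addnA leq_addr.
  have : \sum_(i < h) (rep i + 1) <= \sum_(i < h) (l i + 2) * g ^ kk s.
    by apply: leq_sum => i _; rewrite addn1; case: (fP i) => _ _ /andP[].
  by rewrite -big_distrl /= !big_split /= !sum_nat_const card_ord; lia.
have hi : \sum_i l i <= lamb h + 1.
  rewrite -ltnS -addnS -(ltn_pmul2r (gX_gt0 (kk s))).
  apply: leq_ltn_trans n_lt; rewrite -sum_rep big_distrl; apply: leq_sum => i _.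
  by case: (fP i) => _ _ /andP[].
have [manyB|[q lt_q [p p_inj kp]]] := window_sum_forced h_gt1 okk El lo hi.
  have [i0 Bi] := sum_isB manyB; exists i0.
  apply: AA_mod_inj => //; set m := mp (ty s).
  (* Below m the b-elements consist of markers only, which cancel the marker part of [base s] modulo
     g ^ m and leave a. *)
  have Esum : \sum_(i < h | i != i0) rep i = (h - 1) * num g m bdig %[mod g ^ m].
    have -> : (h - 1) * num g m bdig = \sum_(i < h | i != i0) num g m bdig.
      by rewrite sum_nat_const cardC1 card_ord subn1.
    rewrite -modn_summ -[in RHS]modn_summ; congr (_ %% _).
    apply: eq_bigr => i /Bi; have [_ _ _] := fP i; rewrite -/(k i).
    by case: (k i) => //= -> _; rewrite modn_mod.
  have Ed : num g (kk s) d = ty s %[mod g ^ m].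
    rewrite (num_modX d le_m) (eq_num _ (d' := digit g (ty s))).
      by rewrite num_digit // modn_mod.
    by case: pd.
  apply/eqP; rewrite -(eqn_modDl (\sum_(i < h | i != i0) rep i)); apply/eqP.
  have -> : \sum_(i < h | i != i0) rep i + rep i0 = \sum_i rep i.
    by rewrite [RHS](bigD1 i0) //= addnC.
  have -> : \sum_i rep i = lamb h * g ^ (kk s - m) * g ^ m +
      ((h - 1) * num g (kk s) bdig + num g (kk s) d).
    by rewrite sum_rep /base -addnA -(mulnA (lamb h)) -expnD subnK.
  rewrite modnMDl -modnDm Ed -[X in X + _]modnMmr (num_modX bdig le_m) modnMmr.
  by rewrite -Esum modnDm.
have /fin_all_exists[dr drP] (r : 'I_h) : exists dr : nat -> nat, [/\ dig (own_is r) dr,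
    q = r -> O (p r) = gm h -> bad q (ty s) (kk s) dr &
    rep (p r) = elt (kk s) (l (p r)) (cdig r) dr].
  have [_ _ _] := fP (p r); rewrite -/(k (p r)) -/(l (p r)) -/(O (p r)) kp.
  by move=> [dr [? ? ?]]; exists dr.
have reind (F : 'I_h -> nat) : \sum_i F i = \sum_r F (p r) by rewrite (reindex_inj p_inj).
(* The roles own disjoint positions, so the tails add without carry and each digit of the sum comes
   from the owner of its position. *)
pose dd w := \sum_r dr r w.
have ddE w : dd w = dr (Ordinal (own_lt w)) w.
  rewrite /dd (bigD1 (Ordinal (own_lt w))) //= big1 ?addn0 // => r ne_r.
  have [[_ d0] _ _] := drP r; apply: d0; rewrite /own_is.
  by apply: contra ne_r => /eqP Er; apply/eqP/val_inj.
have dd_lt w : dd w < g by rewrite ddE; have [[]] := drP (Ordinal (own_lt w)).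
pose qo := Ordinal lt_q.
have suml : \sum_i l i + gm h = lamb h + O (p qo).
  rewrite reind; apply: (@sum_leads _ h_gt1 qo (D \o p) (O \o p)) => [r|r] /=.
    by have := okk (p r); rewrite kp.
  exact: El.
have : (\sum_i l i) * g ^ kk s + (h - 1) * num g (kk s) bdig + num g (kk s) dd =
       base s + num g (kk s) d.
  rewrite -sum_rep (reind rep) (reind l) -(role_sum (kk s) (l \o p) dr).
  by apply: eq_bigr => r _; case: (drP r).
have ddlt := ltn_num g_gt1 (k := kk s) (fun w _ => dd_lt w).
rewrite /base => Esum.
have El0 : \sum_i l i = lamb h.
  have E : (\sum_i l i) * g ^ kk s + num g (kk s) dd =
           lamb h * g ^ kk s + num g (kk s) d by lia.
  have := congr1 (divn^~ (g ^ kk s)) E.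
  by rewrite !divnMDl // !divn_small // !addn0.
have Edd : num g (kk s) dd = num g (kk s) d by move: Esum; rewrite El0; lia.
have Ed := num_inj g_gt1 (fun w _ => dd_lt w) (fun w _ => d_lt w) Edd.
(* The leads add up to exactly lambda, so role q has offset gm and [bad] applies to it, yet d is a
   special tail with the same q-digits. *)
have [_ /(_ erefl) badq _] := drP qo.
have /badq : O (p qo) = gm h by lia.
case/(_ d) => // w lt_w Ew; rewrite -Ed // ddE.
by congr (dr _ _); apply: val_inj; rewrite /= Ew.
Qed.

(** * Covering all large integers *)

Definition piece (V : pred nat) (d : nat -> nat) w := if V w then d w else 0.

Lemma dig_piece V d : (forall w, d w < g) -> dig V (piece V d).
Proof.
by move=> d_lt; split=> w; rewrite /piece; [case: ifP | move/negbTE->].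
Qed.

Lemma sum_piece d w : \sum_(r < h) piece (own_is r) d w = d w.
Proof.
rewrite (bigD1 (Ordinal (own_lt w))) //= big1 => [|r ne_r].
  by rewrite addn0 /piece /own_is eqxx.
rewrite /piece; case: ifP => // /eqP Er; case/eqP: ne_r; exact: val_inj.
Qed.

(* Each of the conditions of [pat] concerns the digits of a single role. *)
Lemma pat_or_bad a k d : mp a <= k -> (forall w, d w < g) ->
  pat a k d \/ exists q : 'I_h, bad q a k (piece (own_is q) d).
Proof.
move=> le_m d_lt; have h_gt0 : 0 < h by apply: ltnW.
have agree q d' w : (forall w, w < k -> own w = q -> d' w = piece (own_is q) d w) ->
    w < k -> own w = q -> d' w = d w.
  by move=> Ed lt_w Ew; rewrite Ed // /piece /own_is Ew eqxx.
have [/forallP low|/forallPn[w nlow]] :=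
    boolP [forall w : 'I_(mp a), d w == digit g a w]; last first.
  right; exists (Ordinal (own_lt w)) => d' _ Ed [low _ _].
  case/eqP: nlow; rewrite -low //; apply/esym/(agree _ _ _ Ed) => //.
  exact: leq_trans le_m.
have [/forallP ext|/forallPn[w next]] :=
    boolP [forall w : 'I_k, (mp a <= w) ==> extra w ==> (d w == 0)]; last first.
  move: next; rewrite !negb_imply => /and3P[le_w ext_w nz].
  right; exists (Ordinal h_gt0) => d' _ Ed [_ ext _].
  case/eqP: nz; rewrite -(ext w) ?le_w ?ltn_ord //.
  by apply/esym/(agree _ _ _ Ed); rewrite // /own ext_w.
have [/forallP gap|/forallPn[t]] :=
    boolP [forall t : 'I_k, (mp a <= sp t) ==> (wp t < k) ==>
             [exists p : 'I_k, (sp t < p < wp t) && (d p < h)]]; last first.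
  rewrite negb_imply => /andP[le_t].
  rewrite negb_imply => /andP[lt_t]; rewrite negb_exists => /forallP nogap.
  right; exists (Ordinal h_gt0) => d' _ Ed [_ _ gap].
  have [p p_bnd d'p] := gap t le_t lt_t.
  have lt_p : p < k by lia.
  have := nogap (Ordinal lt_p); rewrite p_bnd /= -(agree _ _ _ Ed) ?d'p //.
  rewrite /own; suff -> : inblk p by rewrite orbT.
  by apply/inblkP; exists t; lia.
left; split=> [w lt_w|w /andP[le_w lt_w] ext_w|t le_t lt_t].
- exact/eqP/(low (Ordinal lt_w)).
- by have := ext (Ordinal lt_w); rewrite /= le_w ext_w => /eqP.
- have lt_tk : t < k by apply: leq_trans lt_t; apply/ltnW/wp_gt.
  have := gap (Ordinal lt_tk); rewrite /= le_t lt_t => /existsP[p /andP[p_bnd dp]].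
  by exists p.
Qed.

Definition sumsetP (B : nat -> Prop) n :=
  exists2 a : 'I_h -> nat, forall i, B (a i) & n = \sum_i a i.

Lemma sumset_base s d : flag s -> (forall w, d w < g) -> pat (ty s) (kk s) d ->
  sumsetP AA (base s + num g (kk s) d).
Proof.
move=> fs d_lt pd; have [As_a le_m] := fs; have [low ext gap] := pd.
pose m := mp (ty s).
pose l t := blead t * HH h - ze h.
pose dt t := piece (wown_is t m) d.
pose a i := if i < h - 1 then elt (kk s) (l i) bdig (dt i) else ty s.
exists a => [i|].
  rewrite /a; case: ifP => lt_i; last by exists s.
  apply/AAP; exists s; apply: Or33; exists (i : nat), (l i), (dt i); split=> //.
  - rewrite subnK // -[X in _ <= X]addn0; apply: (@lead_pos _ h_gt1 KB) => //.
    by split=> //; rewrite /blead; case: eqP; [right|left].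
  - exact: dig_piece.
  - move=> t le_t lt_t; have [p p_bnd dp] := gap t le_t lt_t; exists p => //.
    by rewrite /dt /piece; case: ifP => // _; apply: ltnW.
rewrite /a (sum_last h_gt1 (fun i => elt (kk s) (l i) bdig (dt i))).
(* The D add up to vv, and (h - 1) ze = gp is the difference between vv HH and lambda. *)
have sl : \sum_(i < h - 1) l i = lamb h.
  have Eb : \sum_(i < h - 1) blead i = vv h.
    have vgt : h < vv h.
      have := vv_gt h_gt1; have := MM_gt h_gt1 => M V.
      apply: leq_trans (ltnW V); rewrite mulnA (leq_trans M) // leq_pmull //.
      by rewrite muln_gt0 ltnW.
    rewrite /blead; case Eh : (h - 1) => [|n]; first by lia.
    by rewrite big_ord_recl /= sum_nat_const card_ord; lia.
  have : \sum_(i < h - 1) (l i + ze h) = \sum_(i < h - 1) blead i * HH h.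
    apply: eq_bigr => i _; rewrite subnK // -[X in _ <= X]addn0.
    apply: (@lead_pos _ h_gt1 KB) => //.
    by split=> //; rewrite /blead; case: eqP; [right|left].
  rewrite big_split /= sum_nat_const card_ord -big_distrl /= Eb.
  have -> : (h - 1) * ze h = gp h by rewrite /gp /ze mulnCA.
  by rewrite /lamb => <-; rewrite addnK.
rewrite big_split /= -big_distrl /= sl /base -!addnA; congr (_ + _).
rewrite (eq_bigr (fun i : 'I_(h - 1) => num g (kk s) bdig + num g (kk s) (dt i))); last first.
  by move=> i _; rewrite numD.
rewrite big_split /= sum_nat_const card_ord -addnA; congr (_ + _).
have a_lt : ty s < g ^ m.
  apply: leq_trans (ltn_expl _ g_gt1) _; rewrite leq_exp2l //.
  by apply: ltnW; apply: leq_trans (sp_gt _) _; rewrite /m /mp; have := wp_bnd (ty s); lia.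
have -> : ty s = num g (kk s) (digit g (ty s)).
  by rewrite num_digit // modn_small // (leq_trans a_lt) // leq_exp2l.
(* Below m only a has digits. From m on a has none, extra positions carry 0 by [pat], and each other
   position belongs to exactly one b-element. *)
rewrite -num_sum -numD; apply: eq_num => w lt_w.
have [lt_wm|le_mw] := ltnP w m.
  rewrite -low // big1 // => t _; rewrite /dt /piece /wown_is.
  by rewrite leqNgt lt_wm !andbF.
have -> : digit g (ty s) w = 0.
  by rewrite /digit divn_small ?mod0n // (leq_trans a_lt) // leq_exp2l.
have [ext_w|next_w] := boolP (extra w).
  rewrite ext ?le_mw // big1 // => t _; rewrite /dt /piece /wown_is.
  by rewrite ext_w.
rewrite addn0 (bigD1 (Ordinal (wown_lt next_w))) //= big1 => [|t ne_t].
  by rewrite addn0 /dt /piece /wown_is next_w eqxx le_mw.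
rewrite /dt /piece /wown_is; case: ifP => // /and3P[_ /eqP Et _].
by case/eqP: ne_t; apply: val_inj.
Qed.

Lemma cover_AA n : g <= n -> sumsetP AA n.
Proof.
move=> n_ge.
have Dl_gt0 : 0 < Dl by have := Dl_gt; lia.
have ex0 : exists s, g * g ^ kk s <= n.
  by exists 0; rewrite /kk muln0 muln1.
have bound s : g * g ^ kk s <= n -> s <= n.
  move=> le_n; apply: leq_trans le_n; apply: leq_trans (leq_pmull _ g_gt0).
  apply: leq_trans (ltnW (ltn_expl s g_gt1)) _; rewrite leq_exp2l //.
  by rewrite /kk leq_pmull.
case: (ex_maxnP ex0 bound) => s s_le s_max.
have n_lt : n < TT h * g ^ kk s.
  (* [TT] is g * g ^ Dl, so the leads of stage s reach to where stage s + 1 takes over. *)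
  rewrite ltnNge; apply/negP => le_n; suff /s_max : g * g ^ kk s.+1 <= n by rewrite ltnn.
  by apply: leq_trans le_n; rewrite /TT -/Dl -mulnA -expnD /kk mulnS.
have Zlt := Zb_lt (kk s); set G := g ^ kk s in Zlt s_le n_lt *.
set Z := (h - 1) * num g (kk s) bdig in Zlt *.
pose l := (n - Z) %/ G; pose d := digit g (n - Z).
have G_gt0 : 0 < G := gX_gt0 _.
have d_lt w : d w < g by apply: digit_lt.
have En : n = l * G + Z + num g (kk s) d.
  by rewrite num_digit // addnAC -divn_eq; lia.
have l_bnd : h <= l <= TT h.
  apply/andP; split; first by rewrite leq_divRL //; move: s_le; rewrite mulSn; lia.
  by rewrite -ltnS ltn_divLR // mulSn; lia.
pose dr (r : 'I_h) := piece (own_is r) d.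
have sumE (f : 'I_h -> nat) : \sum_r f r = l ->
    n = \sum_r elt (kk s) (f r) (cdig r) (dr r).
  move=> sf; rewrite role_sum sf {1}En; congr (_ + _).
  by apply: eq_num => w _; rewrite sum_piece.
have [[f fP sf]|[e e_le le]] := cover_lead h_gt1 l_bnd.
  exists (fun r : 'I_h => elt (kk s) (f r) (cdig r) (dr r)); last exact: sumE.
  move=> r; apply/AAP; exists s; apply: Or31; exists (r : nat), (f r), (dr r).
  by split=> //; [apply: fP | apply: dig_piece].
(* In the window a c-family is used; the offset of its role q follows e and equals gm only at lead
   lambda. *)
have c_cover (q : 'I_h) : (e = Em h -> flag s -> bad q (ty s) (kk s) (dr q)) ->
    sumsetP AA n.
  move=> badq; pose O := gm h - Em h + e.
  have OE : O = gm h -> e = Em h by rewrite /O /gm /Em; lia.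
  pose Dr (r : 'I_h) := if q == r then cbig h q else cd h q r.
  pose Or (r : 'I_h) := if q == r then O else gm h.
  have ok (r : 'I_h) : lead_ok h (KC q r) (Dr r) (Or r).
    have Em_le : Em h <= gm h by rewrite /gm /Em; lia.
    rewrite /lead_ok /Dr /Or val_eqE; split=> //; case: (q == r); split=> //.
    by rewrite /O; lia.
  pose lr r := Dr r * HH h + Or r - ze h.
  have El r : lr r + ze h = Dr r * HH h + Or r.
    by rewrite subnK //; apply: lead_pos (ok r).
  have sl : \sum_r lr r = l.
    have : \sum_r lr r + gm h = lamb h + O by rewrite (sum_leads h_gt1 ok El) /Or eqxx.
    move: le; rewrite /O; have : Em h <= gm h by rewrite /gm /Em; lia.
    by move: (\sum_r lr r) => S; lia.
  exists (fun r : 'I_h => elt (kk s) (lr r) (cdig r) (dr r)); last exact: sumE.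
  move=> r; apply/AAP; exists s; apply: Or32.
  exists (q : nat), (r : nat), (Dr r), (Or r), (lr r), (dr r); split=> //.
    exact: dig_piece.
  move=> /val_inj <-; rewrite /Or eqxx => /OE ee fs; exact: badq.
(* Only a special tail at lead lambda in a flagged stage calls for b-elements; in all other cases
   some family is admissible. *)
have [[Ee [fs pd]]|npat] := classic (e = Em h /\ flag s /\ pat (ty s) (kk s) d).
  suff -> : n = base s + num g (kk s) d by apply: sumset_base.
  by rewrite En /base -/G; congr (_ * _ + _ + _); lia.
have [fs|nfs] := classic (flag s); last first.
  by apply: (c_cover (Ordinal (ltnW h_gt1))).
have [pd|[q badq]] := @pat_or_bad (ty s) (kk s) d (proj2 fs) d_lt.
  apply: (c_cover (Ordinal (ltnW h_gt1))) => Ee _.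
  by case: npat.
by apply: (c_cover q).
Qed.

Lemma needed s d : flag s -> (forall w, d w < g) -> pat (ty s) (kk s) d ->
  let n := base s + num g (kk s) d in
  sumsetP AA n /\ ~ sumsetP (fun x => AA x /\ x <> ty s) n.
Proof.
move=> fs d_lt pd; split; first exact: sumset_base.
move=> [a aP En]; have [] := rep_uses_type fs d_lt pd (fun i => proj1 (aP i)) (esym En).
by move=> i; case: (aP i).
Qed.

(** Stage s' starts at g ^ kk s' and a < g ^ mp a, so a enters before every stage s with mp a <= kk
    s. *)
Lemma flag_eventually a s : AA a -> ty s = a -> mp a <= kk s -> flag s.
Proof.
move=> /AAP[s' sx] Es le_m; split; rewrite Es //; apply/AsP; exists s' => //.
have /andP[a_ge _] := stage_bnd sx.
rewrite -(ltn_pmul2l (_ : 0 < Dl)); last by have := Dl_gt; lia.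
rewrite -(ltn_exp2l _ _ g_gt1); apply: leq_ltn_trans a_ge _.
apply: leq_trans (ltn_expl a g_gt1) _; rewrite leq_exp2l //.
apply: leq_trans le_m; rewrite /mp.
by have := sp_gt a; have := wp_bnd a; lia.
Qed.

End Stages.

(** * Counting *)

Section DigitLists.
Variable g : nat.
Hypothesis g_gt1 : 1 < g.

Fixpoint dlist (D : nat -> seq nat) k : seq nat :=
  if k is k'.+1 then [seq x + c * g ^ k' | x <- dlist D k', c <- D k'] else [:: 0].

Lemma size_dlist D k : size (dlist D k) = \prod_(w < k) size (D w).
Proof.
elim: k => [|k IHk]; first by rewrite big_ord0.
by rewrite big_ord_recr /= size_allpairs IHk.
Qed.

Lemma mem_dlist D k d : (forall w, w < k -> d w \in D w) -> num g k d \in dlist D k.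
Proof.
elim: k => [|k IHk] dD; first by rewrite /num big_ord0 inE.
rewrite numS /=; apply/allpairsP; exists (num g k d, d k); split=> //=.
  by apply: IHk => w lt_w; apply: dD; apply: ltnW.
exact: dD.
Qed.

Lemma dlistP D k x : x \in dlist D k ->
  exists d, [/\ forall w, w < k -> d w \in D w, forall w, k <= w -> d w = 0 & x = num g k d].
Proof.
elim: k x => [|k IHk] x /=.
  by rewrite inE => /eqP->; exists (fun=> 0); split=> //; rewrite /num big_ord0.
case/allpairsP=> [[y c] /= [/IHk[d [dD d0 ->]] cD ->]].
exists (fun w => if w == k then c else d w); split=> [w|w|].
- by rewrite ltnS leq_eqVlt; case: eqVneq => [->//|_] /= /dD.
- by case: eqVneq => [->|_ /ltnW/d0//]; rewrite ltnn.
- rewrite numS eqxx; congr (_ + _); apply: eq_num => w.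
  by case: eqVneq => // ->; rewrite ltnn.
Qed.

Lemma uniq_dlist D k : (forall w, w < k -> uniq (D w)) ->
  (forall w c, w < k -> c \in D w -> c < g) -> uniq (dlist D k).
Proof.
elim: k => [|k IHk] // uD ltD /=.
have {}IHk : uniq (dlist D k).
  by apply: IHk => [w lt_w|w c lt_w]; [apply: uD | apply: ltD]; apply: ltnW.
apply: allpairs_uniq => //; first exact: uD.
move=> [x1 c1] [x2 c2] /allpairsP[[y1 b1] /= [y1D b1D [-> ->]]].
move=> /allpairsP[[y2 b2] /= [y2D b2D [-> ->]]].
have lt_dl y : y \in dlist D k -> y < g ^ k.
  move=> /dlistP[d [dD _ ->]]; apply: ltn_num => // w lt_w.
  by apply: ltD (dD _ lt_w); apply: ltnW.
move=> E; have g0 : 0 < g ^ k by rewrite expn_gt0 ltnW.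
have Ex : y1 = y2.
  have := congr1 (modn^~ (g ^ k)) E.
  by rewrite /= !(addnC _ (_ * _)) !modnMDl !modn_small // lt_dl.
by move: E; rewrite Ex => /addnI/eqP; rewrite eqn_pmul2r // => /eqP->.
Qed.

End DigitLists.

Definition cnt (V : pred nat) k := \sum_(w < k) V w.

Lemma prod_cnt g (V : pred nat) k : \prod_(w < k) (if V w then g else 1) = g ^ cnt V k.
Proof.
elim: k => [|k IHk]; first by rewrite /cnt !big_ord0.
rewrite /cnt !big_ord_recr /= -/(cnt V k) IHk expnD; congr (_ * _).
by case: (V k).
Qed.

Lemma leq_prod n (F G : nat -> nat) : (forall i, i < n -> F i <= G i) ->
  \prod_(i < n) F i <= \prod_(i < n) G i.
Proof.
move=> FG; elim: n FG => [|n IHn] FG; first by rewrite !big_ord0.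
rewrite !big_ord_recr /= leq_mul ?FG // IHn // => i lt_i.
by apply: FG; apply: ltnW.
Qed.

(** The induction carries the sharper bound N (1/2 - 1/2^(n+1)), cleared of denominators. *)
Lemma sum_geom_half N (b : nat -> nat) n : (forall t, t < n -> b t * 2 ^ t.+2 <= N) ->
  2 * \sum_(t < n) b t <= N.
Proof.
move=> bN; suff : (\sum_(t < n) b t) * 2 ^ n.+1 + N <= N * 2 ^ n.
  move: (\sum_(t < n) b t) => S; rewrite expnS.
  have : 0 < 2 ^ n by rewrite expn_gt0.
  by move: (2 ^ n) => X; nia.
elim: n bN => [|n IHn] bN; first by rewrite big_ord0 mul0n expn0 muln1.
rewrite big_ord_recr /= mulnDl; have bn := bN n (ltnSn n).
have {}IHn : (\sum_(t < n) b t) * 2 ^ n.+1 + N <= N * 2 ^ n.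
  by apply: IHn => t lt_t; apply: bN; apply: ltnW.
move: bn IHn; rewrite !expnS; move: (\sum_(t < n) b t) (2 ^ n) (b n) => S X B.
by lia.
Qed.

Lemma size_filter_union (T : eqType) (s : seq T) (l : nat -> seq T) (n : nat) (P : pred nat) :
  uniq s ->
  size s <= size [seq x <- s | ~~ has (fun t => P t && (x \in l t)) (iota 0 n)] +
            \sum_(t < n) P t * size (l t).
Proof.
move=> us; rewrite size_filter.
rewrite -(count_predC (fun x => has (fun t => P t && (x \in l t)) (iota 0 n)) s) addnC.
rewrite leq_add2l; elim: n => [|n IHn]; first by rewrite count_pred0.
rewrite big_ord_recr [X in _ <= X]/=.
have -> : iota 0 n.+1 = iota 0 n ++ [:: n] by rewrite -addn1 iotaD.
rewrite (eq_count (a2 := predU (fun x => has (fun t => P t && (x \in l t)) (iota 0 n))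
    (fun x => P n && (x \in l n)))); last first.
  by move=> x; rewrite has_cat /= orbF.
apply: (@leq_trans (count (fun x => has (fun t => P t && (x \in l t)) (iota 0 n)) s +
    count (fun x => P n && (x \in l n)) s)).
  by rewrite -count_predUI leq_addr.
apply: leq_add => //; case: (P n) => /=; last by rewrite count_pred0.
rewrite mul1n -size_filter; apply: uniq_leq_size; first exact: filter_uniq.
by move=> x; rewrite mem_filter => /andP[].
Qed.

Lemma cnt_interval a b k : cnt (fun w => a < w < b) k = minn k b - a.+1.
Proof.
rewrite /cnt; elim: k => [|k IHk]; first by rewrite big_ord0 min0n.
by rewrite big_ord_recr /= IHk; case: (ltnP a k); case: (ltnP k b) => /=; lia.
Qed.

Lemma leq_cnt (V V' : pred nat) k : (forall w, w < k -> V w -> V' w) -> cnt V k <= cnt V' k.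
Proof. by move=> VV; apply: leq_sum => w _; case: (V w) (VV w (ltn_ord w)) => // ->. Qed.

Lemma size_flatten_le (S T : eqType) (s : seq S) (f : S -> seq T) N :
  (forall x, x \in s -> size (f x) <= N) -> size (flatten (map f s)) <= size s * N.
Proof.
elim: s => //= x s IHs fN; rewrite size_cat mulSn leq_add ?fN ?mem_head // IHs // => y ys.
by rewrite fN // inE ys orbT.
Qed.

Section Counting.
Variable h : nat.
Hypothesis h_gt1 : 1 < h.
Variables (extra : pred nat) (wown : nat -> nat) (K : nat).
Hypothesis wown_lt : forall w, ~~ extra w -> wown w < h - 1.
Hypothesis extraS : forall w, extra w -> ~~ extra w.+1.
Hypothesis K_gt : 2 * Dl h + 6 <= K.

Local Notation g := h.+1.
Local Notation own := (own extra wown K).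
Local Notation own_is := (own_is extra wown K).
Local Notation kk := (kk h).
Local Notation mp := (mp h extra K).
Local Notation sp := (sp K).
Local Notation wp := (wp extra K).
Local Notation stage := (stage h extra wown K).
Local Notation pat := (pat h extra K).

Let g_gt1 : 1 < g. Proof. by rewrite ltnS ltnW. Qed.

Definition digs (V : pred nat) w := if V w then iota 0 g else [:: 0].

Lemma size_digs V k : size (dlist g (digs V) k) = g ^ cnt V k.
Proof.
rewrite size_dlist -prod_cnt; apply: eq_bigr => w _; rewrite /digs.
by case: ifP => _; rewrite ?size_iota.
Qed.

Lemma mem_digs (V : pred nat) k d : (forall w, d w < g) -> (forall w, ~~ V w -> d w = 0) ->
  num g k d \in dlist g (digs V) k.
Proof.
move=> d_lt d0; apply: mem_dlist => w _; rewrite /digs.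
by case: ifP => [_|/negbT/d0->]; [rewrite mem_iota; apply: d_lt | rewrite inE].
Qed.

(** Lead, role (or b-index) and free digits determine an element; the family of a c-element adds
    nothing, as markers depend on the role only. *)
Lemma stage_list s e : (forall r, cnt (own_is r) (kk s) <= e) ->
  (forall t, t < h - 1 -> cnt (fun w => ~~ extra w && (wown w == t)) (kk s) <= e) ->
  exists2 L : seq nat, forall fl x, stage fl s x -> x \in L &
    size L <= (TT h).+1 * (2 * h * g ^ e).
Proof.
move=> own_le wown_le; set k := kk s in own_le wown_le *.
pose zo := flatten [seq [seq num g k (cdig h extra K r) + x
  | x <- dlist g (digs (own_is r)) k] | r <- iota 0 h].
pose zb := flatten [seq [seq num g k (bdig extra K) + x
  | x <- dlist g (digs (fun w => ~~ extra w && (wown w == t))) k] | t <- iota 0 (h - 1)].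
exists [seq l * g ^ k + z | l <- iota 0 (TT h).+1, z <- zo ++ zb]; last first.
  rewrite size_allpairs size_iota leq_mul2l size_cat; apply/orP; right.
  have -> : 2 * h * g ^ e = h * g ^ e + h * g ^ e by rewrite -mulnA mul2n addnn.
  apply: leq_add.
    rewrite -[h in h * _](size_iota 0); apply: size_flatten_le => r _.
    by rewrite size_map size_digs leq_exp2l.
  apply: (@leq_trans ((h - 1) * g ^ e)); last by rewrite leq_mul2r leq_subr orbT.
  rewrite -[h - 1](size_iota 0); apply: size_flatten_le => t.
  rewrite mem_iota => /andP[_ lt_t].
  by rewrite size_map size_digs leq_exp2l // wown_le.
have key l z : l <= TT h -> z \in zo ++ zb ->
    l * g ^ k + z \in [seq l * g ^ k + z | l <- iota 0 (TT h).+1, z <- zo ++ zb].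
  by move=> l_le zz; apply/allpairsP; exists (l, z); rewrite mem_iota ltnS.
have own_mem r d : r < h -> dig h (own_is r) d ->
    num g k (fun w => cdig h extra K r w + d w) \in zo ++ zb.
  move=> lt_r [d_lt d0]; rewrite mem_cat; apply/orP; left; rewrite numD.
  apply/flatten_mapP; exists r; first by rewrite mem_iota.
  by apply: map_f; apply: mem_digs.
move=> fl x [[r [l [d [lt_r nl dP ->]]]]|[q [r [D [O [l [d [ok El dP _ ->]]]]]]]|].
- by apply: key; [have /andP[] := normal_lead_bnd h_gt1 nl | apply: own_mem].
- apply: key; first by have /andP[] := @lead_bnd _ h_gt1 (KC q r) D O l isT ok El.
  by apply: own_mem => //; case: ok.
case=> t [l [d [lt_t El [d_lt d0] _ ->]]]; apply: key.
  have okB : lead_ok h KB (blead h t) 0.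
    by split=> //; rewrite /blead; case: eqP; [right|left].
  have := @lead_bnd _ h_gt1 KB (blead h t) 0 l isT okB.
  by rewrite addn0 => /(_ El)/andP[].
rewrite mem_cat; apply/orP; right; rewrite numD.
apply/flatten_mapP; exists t; first by rewrite mem_iota.
apply: map_f; apply: mem_digs => // w nV; apply: d0; rewrite /wown_is andbA.
by rewrite (negbTE nV).
Qed.

(** Block t has at least t + 2 inner positions and so spoils at most a share 1/2^(t+2) of the
    candidates; half of them survive all blocks. *)
Lemma pattern_list s : mp (ty s) <= kk s ->
  exists L : seq nat, [/\ uniq L,
    forall x, x \in L -> exists d,
      [/\ forall w, d w < g, pat (ty s) (kk s) d & x = num g (kk s) d] &
    g ^ cnt (fun w => (mp (ty s) <= w) && ~~ extra w) (kk s) <= 2 * size L].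
Proof.
set m := mp (ty s); set k := kk s => le_m.
pose D w := if w < m then [:: digit g (ty s) w] else if extra w then [:: 0] else iota 0 g.
pose Dt t w := [seq c <- D w | (sp t < w < wp t) ==> (c == h)].
pose P t := (m <= sp t) && (wp t < k).
pose V w := (m <= w) && ~~ extra w.
have sizeD w : size (D w) = if V w then g else 1.
  rewrite /D /V; case: ltnP => //= _; case: ifP => _ //=.
  by rewrite size_iota.
have sizeDk : size (dlist g D k) = g ^ cnt V k.
  by rewrite size_dlist -prod_cnt; apply: eq_bigr.
have ltD w c : c \in D w -> c < g.
  rewrite /D; case: ltnP => _; first by rewrite inE => /eqP->; apply: digit_lt.
  by case: ifP => _; [rewrite inE => /eqP-> | rewrite mem_iota].
have uD w : uniq (D w).
  by rewrite /D; case: ltnP => // _; case: ifP => // _; apply: iota_uniq.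
have uDk : uniq (dlist g D k) by apply: uniq_dlist => // w c _; apply: ltD.
exists [seq x <- dlist g D k | ~~ has (fun t => P t && (x \in dlist g (Dt t) k)) (iota 0 k)].
split; first exact: filter_uniq.
- move=> x; rewrite mem_filter => /andP[/hasPn good /dlistP[d [dD d0 Ex]]].
  have d_lt w : d w < g.
    by have [lt_w|/d0->//] := ltnP w k; apply: ltD (dD _ lt_w).
  exists d; split=> //; split=> [w lt_w|w /andP[le_w lt_w] ext_w|t le_t lt_t].
  + have := dD w (leq_trans lt_w le_m); rewrite /D lt_w inE.
    by move/eqP.
  + have := dD w lt_w; rewrite /D ltnNge le_w ext_w inE.
    by move/eqP.
  apply: NNPP => nogap; have lt_tk : t < k.
    by apply: leq_trans lt_t; apply/ltnW/(wp_gt h_gt1 _ K_gt).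
  have : t \in iota 0 k by rewrite mem_iota.
  move/good; rewrite /P le_t lt_t /=; case/negP.
  rewrite Ex; apply: mem_dlist => w lt_w; rewrite mem_filter dD // andbT.
  apply/implyP => w_bnd; apply/eqP; apply: NNPP => ne_dw; apply: nogap.
  by exists w => //; have := d_lt w; lia.
rewrite -/V -sizeDk; have := size_filter_union (fun t => dlist g (Dt t) k) k P uDk.
have : 2 * \sum_(t < k) P t * size (dlist g (Dt t) k) <= size (dlist g D k).
  (* Tails violating [gaps] at block t have all digits inside the block equal to h. *)
  apply: (sum_geom_half (b := fun t => P t * size (dlist g (Dt t) k))) => t _.
  case: (boolP (P t)) => [/andP[le_t lt_t]|]; last by rewrite !mul0n.
  rewrite mul1n.
  apply: (@leq_trans (size (dlist g (Dt t) k) * g ^ cnt (fun w => sp t < w < wp t) k)).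
    rewrite leq_mul2l; apply/orP; right; rewrite cnt_interval.
    apply: (@leq_trans (g ^ t.+2)); first by rewrite leq_exp2r.
    by rewrite leq_exp2l //; have := wp_bnd h_gt1 extra K_gt t; lia.
  rewrite !size_dlist -prod_cnt -big_split /=.
  apply: (@leq_prod k (fun w => size (Dt t w) * (if sp t < w < wp t then g else 1))
    (fun w => size (D w))) => w lt_w.
  case: ifP => w_bnd; last by rewrite muln1 size_filter count_size.
  rewrite /Dt w_bnd /D; have -> : (w < m) = false by lia.
  (* An extra position holds 0, never h, so a block containing one in its interior spoils
     nothing. *)
  case: ifP => _; first by rewrite /= eq_sym (gtn_eqF (ltnW h_gt1)).
  rewrite size_filter size_iota -[X in _ <= X]mul1n leq_mul2r /=.
  rewrite (eq_count (a2 := pred1 h)) // count_uniq_mem ?iota_uniq //.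
  by rewrite (ltn_eqF (ltnW h_gt1)) leq_b1.
move: (size _) (\sum_(t < k) _) (size _) => A S B; lia.
Qed.

End Counting.

(** * Numbers of positions owned by the roles *)

Section Rates.
Variable h : nat.
Hypothesis h_gt1 : 1 < h.
Variable u : nat -> nat.
Hypothesis u0 : u 0 = 0.
Hypothesis uS : forall w, u w <= u w.+1 <= (u w).+1.
Hypothesis uSS : forall w, u w < u w.+2.
Variable K : nat.
Hypothesis K_gt : 2 * Dl h + 6 <= K.

(* u w is the integer part of (h - 1) theta w: the first w positions contain u w
   nonextra ones, which are dealt out cyclically. *)
Definition extra : pred nat := fun w => u w.+1 == u w.
Definition wown w := u w %% (h - 1).

Lemma wown_lt w : ~~ extra w -> wown w < h - 1.
Proof. by move=> _; rewrite ltn_mod; lia. Qed.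

Lemma extraS w : extra w -> ~~ extra w.+1.
Proof. by rewrite /extra => /eqP E; have := uSS w; rewrite -E; lia. Qed.

Lemma cntS V k : cnt V k.+1 = cnt V k + V k.
Proof. by rewrite /cnt big_ord_recr. Qed.

Lemma cnt_nonextra k : cnt (predC extra) k = u k.
Proof.
elim: k => [|k IHk]; first by rewrite /cnt big_ord0 u0.
by rewrite cntS IHk /= /extra; have := uS k; case: eqVneq; lia.
Qed.

Lemma count_mod p t n : t < p -> \sum_(j < n) (j %% p == t) <= n %/ p + 1.
Proof.
move=> lt_tp; suff -> : \sum_(j < n) (j %% p == t) = n %/ p + (t < n %% p).
  by rewrite leq_add2l leq_b1.
elim: n => [|n IHn]; first by rewrite big_ord0 div0n mod0n.
rewrite big_ord_recr /= IHn divnS ?(leq_trans _ lt_tp) // modnS.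
have : n %% p < p by rewrite ltn_mod; lia.
case: ifP => [dv|ndv] /=; last by lia.
have : (n %% p).+1 = p.
  move: dv; rewrite /dvdn -addn1 -modnDml addn1 => /eqP.
  have : n %% p < p by rewrite ltn_mod; lia.
  rewrite leq_eqVlt => /predU1P[->//|lt_n]; rewrite modn_small //.
by lia.
Qed.

Lemma cnt_wown t k : t < h - 1 ->
  cnt (fun w => ~~ extra w && (wown w == t)) k <= u k %/ (h - 1) + 1.
Proof.
move=> lt_t; apply: leq_trans (count_mod _ lt_t).
elim: k => [|k IHk]; first by rewrite /cnt big_ord0.
rewrite cntS; have := uS k; rewrite /extra /wown.
case: (eqVneq (u k.+1) (u k)) => [-> _|ne_u u_bnd] /=; first by rewrite addn0.
have -> : u k.+1 = (u k).+1 by lia.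
by rewrite big_ord_recr leq_add2r.
Qed.

Lemma sum_interval a b n : \sum_(w < n) (a <= w < b) <= minn n b - a.
Proof.
elim: n => [|n IHn]; first by rewrite big_ord0.
by rewrite big_ord_recr /=; move: IHn; case: (ltnP n b); case: (leqP a n) => /=; lia.
Qed.

(** If n > 0 blocks start below k, then K n^2 < k, while their total length is at most 5 n^2. *)
Lemma cnt_inblk k : cnt (inblk extra K) k * K <= 5 * k.
Proof.
have wpb t := wp_bnd h_gt1 extra K_gt t.
pose b n := \sum_(t < n) (sp K t < k) * (t + 4).
have le_b : cnt (inblk extra K) k <= b k.
  apply: (@leq_trans (\sum_(w < k) \sum_(t < k) (sp K t <= w < wp extra K t))).
    apply: leq_sum => w _; case: (boolP (inblk extra K w)) => // /inblkP-/(_ _ h_gt1 K_gt)[t wt].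
    have lt_t : t < k.
      by have := sp_gt h_gt1 K_gt t; have := ltn_ord w; lia.
    by rewrite (bigD1 (Ordinal lt_t)) //= wt.
  rewrite exchange_big /=; apply: leq_sum => t _.
  apply: leq_trans (sum_interval (sp K t) (wp extra K t) k) _.
  by have := wpb t; case: (ltnP (sp K t) k) => /=; lia.
apply: (@leq_trans (b k * K)); first by rewrite leq_mul2r le_b orbT.
have b_sq n : b n <= 5 * (n * n).
  elim: n => [|n IHn]; first by rewrite /b big_ord0.
  by rewrite /b big_ord_recr /= -/(b n); move: IHn; case: (_ < k) => /=; nia.
suff: forall n, b n * K <= 5 * k by apply.
elim=> [|n IHn]; first by rewrite /b big_ord0.
have [lt_k|ge_k] := ltnP (sp K n) k; last first.
  by rewrite /b big_ord_recr /= -/(b n) ltnNge ge_k mul0n addn0.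
apply: (@leq_trans (5 * (n.+1 * n.+1) * K)); first by rewrite leq_mul2r b_sq orbT.
by rewrite -mulnA leq_mul2l mulnC; apply: ltnW.
Qed.

Lemma cnt_own r k :
  cnt (own_is extra wown K r) k <=
    maxn (u k %/ (h - 1) + 1) (k - u k + cnt (inblk extra K) k).
Proof.
case: r => [|r]; rewrite leq_max; apply/orP; [right|left].
  have -> : k - u k = cnt extra k.
    rewrite -cnt_nonextra; suff : cnt extra k + cnt (predC extra) k = k by lia.
    rewrite /cnt -big_split /= -[RHS]card_ord -sum1_card; apply: eq_bigr => w _.
    by case: (extra w).
  rewrite /cnt -big_split /=; apply: leq_sum => w _; rewrite /own_is /own.
  by case: ifP => // /orP[] ->; case: (extra w).
have [lt_r|ge_r] := ltnP r (h - 1).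
  apply: leq_trans (cnt_wown _ lt_r); apply: leq_cnt => w _; rewrite /own_is /own.
  by case: ifP => // /negbT; rewrite negb_or eqSS => /andP[->].
rewrite (leq_trans _ (leq0n _)) // leqn0 sum_nat_eq0; apply/forallP => w.
rewrite implyTb eqb0 /own_is neq_ltn (leq_trans (own_lt h_gt1 wown_lt K_gt w)) //.
by lia.
Qed.

Lemma cnt_pattern m k : u k - m <= cnt (fun w => (m <= w) && ~~ extra w) k.
Proof.
rewrite -cnt_nonextra leq_subLR.
elim: k => [|k IHk]; first by rewrite /cnt !big_ord0.
rewrite !cntS /=; case: (leqP m k) => [_|lt_k] /=; first by lia.
have : cnt (predC extra) k.+1 <= k.+1.
  by rewrite -[X in _ <= X]card_ord -sum1_card; apply: leq_sum => i _; apply: leq_b1.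
by rewrite cntS /=; lia.
Qed.

End Rates.

Unset Implicit Arguments.
Set Strict Implicit.

From mathcomp Require Import all_order all_algebra finmap.
From mathcomp Require Import all_classical all_reals all_analysis.
From mathcomp Require Import ring lra.

Import Order.TTheory GRing.Theory Num.Theory.
Import numFieldNormedType.Exports.

Local Open Scope classical_set_scope.
Local Open Scope ring_scope.

(** * Counting functions and sums needing a given element *)

Lemma finite_upto (R : realType) (x : R) (A : set nat) :
  finite_set (A `&` [set n : nat | n%:R <= x]).
Proof.
apply: (sub_finite_set (B := [set n : nat | (n < (Num.truncn x).+1)%N])).
  by move=> n [_ /= n_le]; rewrite -(ltr_nat R) (le_lt_trans n_le) ?truncnS_gt.
exact: finite_II.
Qed.

Lemma count_upto_le (R : realType) (x : R) (A : set nat) (s : seq nat) :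
  (forall n, A n -> n%:R <= x -> n \in s) -> (count_upto A x <= size s)%N.
Proof.
move=> As; apply: uniq_leq_size; first exact: fset_uniq.
move=> n; rewrite in_fset_set; last exact: finite_upto.
by rewrite inE => -[An nx]; apply: As.
Qed.

Lemma count_upto_ge (R : realType) (x : R) (A : set nat) (s : seq nat) :
  uniq s -> (forall n, n \in s -> A n /\ n%:R <= x) -> (size s <= count_upto A x)%N.
Proof.
move=> us As; apply: uniq_leq_size => // n ns.
by rewrite in_fset_set ?inE; [apply: As | apply: finite_upto].
Qed.

Fixpoint sums j (T : seq nat) : seq nat :=
  if j is j'.+1 then [seq (x + y)%N | x <- T, y <- sums j' T] else [:: 0%N].

Lemma size_sums j T : size (sums j T) = (size T ^ j)%N.
Proof. by elim: j => //= j IHj; rewrite size_allpairs IHj expnS. Qed.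

Lemma mem_sums j T (f : 'I_j -> nat) :
  (forall i, f i \in T) -> (\sum_(i < j) f i)%N \in sums j T.
Proof.
elim: j f => [|j IHj] f fT; first by rewrite big_ord0 inE.
by rewrite big_ord_recl; apply: allpairs_f => //; apply: IHj => i; apply: fT.
Qed.

(** Such a sum is a plus h - 1 elements of A, none above x. *)
Lemma count_sums_needing (R : realType) (x : R) h (A : set nat) a : (0 < h)%N ->
  (count_upto (sums_needing h A a) x <= count_upto A x ^ (h - 1))%N.
Proof.
case: h => // h _; rewrite subn1 /=.
set T := fset_set (A `&` [set n : nat | n%:R <= x]).
rewrite -size_sums -(size_map (addn a)); apply: count_upto_le.
move=> n [[f fA En] no_rep] n_le.
have [i0 fi0] : exists i0, f i0 = a.
  apply: NNPP => no_a; apply: no_rep; exists f => // i.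
  by split; [apply: fA | move=> fi; apply: no_a; exists i].
rewrite En (bigD1_ord i0) //= fi0; apply: map_f; apply: mem_sums => i.
rewrite in_fset_set ?inE; last exact: finite_upto.
split; first exact: fA.
by apply: le_trans n_le; rewrite ler_nat En (bigD1_ord i0) //= (bigD1 i) //= addnCA leq_addr.
Qed.

(** * Densities *)

Section Main.
Variables (R : realType) (h : nat) (theta : R).
Hypothesis h_gt1 : (1 < h)%N.
Hypothesis theta_gt : 1 / h%:R < theta.
Hypothesis theta_le : theta <= 1 / (h - 1)%N%:R.

Let Th : R := (h - 1)%N%:R * theta.
Let g : R := h.+1%:R.

Let h0 : 0 < h%:R :> R. Proof. by rewrite ltr0n ltnW. Qed.
Let h10 : 0 < (h - 1)%N%:R :> R. Proof. by rewrite ltr0n subn_gt0. Qed.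
Let hE : h%:R = (h - 1)%N%:R + 1 :> R. Proof. by rewrite natrB ?subrK // ltnW. Qed.

Let htheta : 1 < h%:R * theta. Proof. by move: theta_gt; rewrite ltr_pdivrMr // mulrC. Qed.
Let Th_le1 : Th <= 1. Proof. by move: theta_le; rewrite ler_pdivlMr // mulrC. Qed.
Let theta0 : 0 < theta.
Proof. by apply: lt_trans theta_gt; rewrite divr_gt0. Qed.
Let ThE : h%:R * theta = Th + theta. Proof. by rewrite hE mulrDl mul1r. Qed.
Let Th_half : 1 <= 2 * Th.
Proof.
have : theta <= Th.
  by rewrite /Th -[X in X <= _]mul1r; apply: ler_wpM2r (ltW theta0) _ _ _; rewrite ler1n subn_gt0.
by move: htheta; rewrite ThE; lra.
Qed.
Let Th0 : 0 < Th. Proof. by move: Th_half; lra. Qed.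

Let u (w : nat) : nat := Num.truncn (Th * w%:R).

Let u_bnd w : (u w)%:R <= Th * w%:R < (u w).+1%:R.
Proof. by apply: truncn_itv; rewrite mulr_ge0 // ltW. Qed.

Let u0 : u 0%N = 0%N. Proof. by rewrite /u mulr0 truncn0. Qed.

Let uS w : (u w <= u w.+1 <= (u w).+1)%N.
Proof.
have /andP[lb ub] := u_bnd w; have /andP[lb' ub'] := u_bnd w.+1.
have wS : w.+1%:R = w%:R + 1 :> R by rewrite natr1.
move: lb' ub'; rewrite wS mulrDr mulr1 => lb' ub'.
apply/andP; split; rewrite -ltnS -(ltr_nat R).
  by rewrite (le_lt_trans lb) // (le_lt_trans _ ub') // lerDl ltW.
by rewrite (le_lt_trans lb') // -natr1 (lt_le_trans (_ : _ < (u w).+1%:R + Th)) ?ltrD2r ?lerD2l.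
Qed.

Let uSS w : (u w < u w.+2)%N.
Proof.
have /andP[lb ub] := u_bnd w; have /andP[lb' ub'] := u_bnd w.+2.
have wS : w.+2%:R = w%:R + 2 :> R by rewrite -addn2 natrD.
move: ub'; rewrite wS mulrDr => ub'.
rewrite -ltnS -(ltr_nat R) (le_lt_trans _ ub') // -natr1.
by rewrite lerD // mulrC.
Qed.

(** Beyond [K_gt], K exceeds 5 / (h theta - 1), so that blocks fill at most a share h theta - 1 of
    the positions. This is where theta > 1/h makes room. *)
Let K : nat := (2 * Dl h + 6 + Num.truncn (5 / (h%:R * theta - 1)) + 1)%N.

Let K_gt : (2 * Dl h + 6 <= K)%N. Proof. exact: leq_trans (leq_addr _ _) (leq_addr _ _). Qed.

Let K5 k : (5 * k)%:R <= (h%:R * theta - 1) * (K * k)%:R :> R.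
Proof.
rewrite !natrM mulrA ler_wpM2r //.
have d0 : 0 < h%:R * theta - 1 by rewrite subr_gt0.
rewrite mulrC -ler_pdivrMr //; apply: ltW.
apply: lt_le_trans (truncnS_gt _) _; by rewrite ler_nat /K addn1 ltnS leq_addl.
Qed.

Local Notation extra := (extra u).
Local Notation wown := (wown h u).
Local Notation AA := (AA h extra wown K).
Local Notation kk := (kk h).

Let wlt w : ~~ extra w -> (wown w < h - 1)%N. Proof. exact: wown_lt. Qed.
Let eS w : extra w -> ~~ extra w.+1. Proof. exact: extraS. Qed.

Let expo k := maxn (u k %/ (h - 1) + 1) (k - u k + cnt (inblk extra K) k).

(** Role 0 has about (1 - Th) k extra positions and at most (h theta - 1) k in blocks, together
    theta k because h theta = Th + theta. *)
Let expo_le k : (expo k)%:R <= theta * k%:R + 2.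
Proof.
have /andP[lb ub] := u_bnd k.
rewrite /expo /maxn; case: ifP => _; last first.
  rewrite natrD; apply: lerD; last by lra.
  have : ((u k %/ (h - 1) * (h - 1))%N%:R <= (u k)%:R :> R) by rewrite ler_nat leq_divM.
  rewrite natrM => H; rewrite -(ler_pM2r h10); apply: le_trans H (le_trans lb _).
  by rewrite /Th; lra.
have uk : (u k <= k)%N.
  by rewrite -(ler_nat R) (le_trans lb) // ler_piMl.
have B : (cnt (inblk extra K) k)%:R <= (h%:R * theta - 1) * k%:R.
  have : ((cnt (inblk extra K) k * K)%N%:R <= (5 * k)%:R :> R).
    by rewrite ler_nat; apply: cnt_inblk h_gt1 u u0 K K_gt k.
  move=> /le_trans/(_ (K5 k)); rewrite !natrM mulrCA mulrC ler_pM2l // ltr0n.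
  by rewrite /K addn1.
rewrite natrD natrB //; move: ub B; rewrite -natr1 ThE; lra.
Qed.

Let g1 : 1 < g. Proof. by rewrite ltr1n ltnS ltnW. Qed.
Let g0 : 0 < g. Proof. exact: lt_trans g1. Qed.
Let gN0 : g != 0. Proof. by rewrite gt_eqF. Qed.

(** The growth factor of the stages: their sizes form a geometric series dominated by the last
    term. *)
Let rho : R := g `^ (theta * (Dl h)%:R).

Let rho1 : 1 < rho.
Proof.
rewrite /rho /powR gt_eqF // expR_gt1 mulr_gt0 ?ln_gt0 // mulr_gt0 // ltr0n.
by apply: leq_ltn_trans (Dl_gt h_gt1 K_gt).
Qed.

Let gX k : (h.+1 ^ k)%:R = g `^ k%:R :> R.
Proof. by rewrite natrX powR_mulrn // ltW. Qed.

Let rhoX s : rho ^+ s = (h.+1 ^ kk s)%:R `^ theta.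
Proof.
rewrite gX -powRrM /rho -powR_mulrn ?powR_ge0 // -powRrM; congr (_ `^ _).
by rewrite /kk natrM; ring.
Qed.

Let C1 : R := ((TT h).+1 * (2 * h))%:R * g ^+ 2.

Let stages_list n : exists2 L : seq nat,
  forall s x, (s < n)%N -> stage h extra wown K (flag h extra wown K s) s x -> x \in L &
  (size L)%:R <= C1 * \sum_(j < n) rho ^+ j.
Proof.
elim: n => [|n [L LP L_le]].
  by exists [::] => //; rewrite big_ord0 mulr0.
have [||L' L'P L'_le] := @stage_list h h_gt1 extra wown K n (expo (kk n)).
- by move=> r; apply: cnt_own.
- by move=> t lt_t; apply: leq_trans (leq_maxl _ _); apply: cnt_wown.
exists (L ++ L').
  move=> s x; rewrite ltnS leq_eqVlt => /predU1P[-> sx|lt_s sx].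
    by rewrite mem_cat (L'P _ _ sx) orbT.
  by rewrite mem_cat (LP s).
rewrite size_cat natrD big_ord_recr /= mulrDr lerD //.
apply: (@le_trans _ _ ((TT h).+1 * (2 * h * h.+1 ^ expo (kk n)))%:R).
  by rewrite ler_nat.
rewrite mulnA natrM /C1 -mulrA ler_wpM2l // gX.
apply: le_trans (ler_powR (ltW g1) (expo_le (kk n))) _.
rewrite powRD; last by rewrite gN0 implybT.
rewrite rhoX gX -powRrM [theta * _]mulrC [X in X <= _]mulrC.
by rewrite -[g ^+ 2]powR_mulrn // ltW.
Qed.

Let geom n : \sum_(j < n.+1) rho ^+ j <= rho / (rho - 1) * rho ^+ n.
Proof.
have r1 : 0 < rho - 1 by rewrite subr_gt0.
rewrite -(ler_pM2l r1) -subrX1 mulrA mulrCA divff ?gt_eqF // mulr1 -exprS.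
by rewrite gerBl.
Qed.

Let C : R := C1 * (rho / (rho - 1)).

Let C1_gt0 : 0 < C1.
Proof. by rewrite mulr_gt0 ?exprn_gt0 // ltr0n !muln_gt0 /= ltnW. Qed.

Let C_gt0 : 0 < C.
Proof.
have r1 : 0 < rho - 1 by rewrite subr_gt0.
by rewrite mulr_gt0 // divr_gt0 // (lt_trans _ rho1).
Qed.

Let A_upper (x : R) : 1 <= x -> (count_upto AA x)%:R <= C * x `^ theta.
Proof.
move=> x1; have x0 : 0 <= x by apply: le_trans x1.
have ex0 : exists s, ((h.+1 ^ kk s)%:R <= x) by exists 0%N; rewrite /kk muln0.
have bound s : (h.+1 ^ kk s)%:R <= x -> (s <= Num.truncn x)%N.
  rewrite -truncn_ge_nat // => /(leq_trans _)-> //.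
  apply: leq_trans (ltnW (ltn_expl s (_ : 1 < h.+1)%N)) _; first by rewrite ltnS ltnW.
  rewrite leq_exp2l ?ltnS ?(ltnW h_gt1) // /kk leq_pmull //.
  by apply: leq_ltn_trans (Dl_gt h_gt1 K_gt).
have [s s_le s_max] := ex_maxnP ex0 bound.
have [L LP L_le] := stages_list s.+1.
apply: (@le_trans _ _ (size L)%:R).
  rewrite ler_nat; apply: count_upto_le => n /AAP[s' sx] n_le.
  apply: LP (sx); rewrite ltnS; apply: s_max; apply: le_trans n_le.
  by rewrite ler_nat; have /andP[] := stage_bnd h_gt1 eS K_gt sx.
apply: le_trans L_le _.
apply: (@le_trans _ _ (C1 * (rho / (rho - 1) * rho ^+ s))).
  by rewrite ler_pM2l //; apply: geom.
rewrite mulrA -/C ler_wpM2l ?(ltW C_gt0) // rhoX.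
by apply: ge0_ler_powR; rewrite ?nnegrE // ltW.
Qed.

Let E_lower a : AA a -> exists2 c : R, 0 < c & exists M : R, forall x, M <= x ->
  c * x `^ Th <= (count_upto (sums_needing h AA a) x)%:R.
Proof.
(* These are the stages of type a. Consecutive ones differ by 2^(a+1), so the last usable one loses
   only a constant factor against x. *)
move=> Aa; pose s j := (2 ^ a * (2 * j).+1 - 1)%N.
pose m := mp h extra K a.
have sS j : (s j).+1 = (2 ^ a * (2 * j).+1)%N.
  by rewrite /s subn1 prednK // muln_gt0 expn_gt0.
have ty_s j : ty (s j) = a.
  rewrite /ty sS lognM ?expn_gt0 // pfactorK // logn_coprime ?addn0 //.
  by rewrite coprime2n /= oddM.
have s_ge j : (j <= s j)%N.
  rewrite -ltnS sS; apply: leq_trans (leq_pmull _ _); last by rewrite expn_gt0.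
  by rewrite ltnS leq_pmull.
have Dl0 : (0 < Dl h)%N by apply: leq_ltn_trans (Dl_gt h_gt1 K_gt).
have kk_ge j : (j <= kk (s j))%N by apply: leq_trans (s_ge j) (leq_pmull _ Dl0).
pose D' := (Dl h * 2 ^ a.+1)%N.
have kkS j : kk (s j.+1) = (kk (s j) + D')%N.
  rewrite /kk /D' -mulnDr; congr (_ * _)%N; apply: succn_inj.
  rewrite sS -addSn sS expnS (mulnC 2 (2 ^ a))%N -mulnDr; congr (_ * _)%N.
  by rewrite addSn mulnS addnC.
pose V : nat := (vv h * HH h)%N.
have V0 : (0 < V)%N by have := Dl0.
pose N j := (V * h.+1 ^ kk (s j))%N.
pose c : R := g `^ (- 1 - m%:R) / (2 * V%:R `^ Th * g `^ (Th * D'%:R)).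
exists c.
  by rewrite divr_gt0 ?powR_gt0 // !mulr_gt0 ?powR_gt0 // ltr0n.
(* From N m on, the chosen j is at least m, so mp a <= kk (s j) and the stage is flagged. *)
exists (N m)%:R => x x_ge.
have ex0 : exists j, (N j)%:R <= x by exists m.
have bound j : (N j)%:R <= x -> (j <= Num.truncn x)%N.
  rewrite -truncn_ge_nat; last by apply: le_trans x_ge.
  move/(leq_trans _) => -> //; rewrite /N; apply: leq_trans (leq_pmull _ V0).
  apply: leq_trans (ltnW (ltn_expl j (_ : 1 < h.+1)%N)) _; first by rewrite ltnS ltnW.
  by rewrite leq_exp2l ?ltnS ?(ltnW h_gt1).
have [j j_le j_max] := ex_maxnP ex0 bound.
have m_le : (m <= kk (s j))%N by apply: leq_trans (j_max m x_ge) (kk_ge j).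
have fs : flag h extra wown K (s j).
  by apply: (flag_eventually h_gt1 eS K_gt Aa).
have := @pattern_list h h_gt1 extra K K_gt (s j).
rewrite ty_s => /(_ m_le) [L [uL LP L_size]].
have x_lt : x < (V * h.+1 ^ (kk (s j) + D'))%:R.
  rewrite -kkS -/(N j.+1) ltNge; apply/negP => /j_max; rewrite ltnn.
  by [].
have L_count : (size L <= count_upto (sums_needing h AA a) x)%N.
  rewrite -(size_map (addn (base h extra K (s j)))); apply: count_upto_ge.
    by rewrite map_inj_uniq // => ? ? /addnI.
  move=> n /mapP[y yL ->]; have [d [d_lt pd Ey]] := LP _ yL; rewrite -(ty_s j) in pd.
  have [yes no] := needed h_gt1 wlt eS K_gt fs d_lt pd.
  rewrite -Ey in yes no; split.
    by split=> //; move: no; rewrite ty_s.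
  apply: le_trans j_le; rewrite ler_nat /N.
  have ylt : (y < h.+1 ^ kk (s j))%N.
    by rewrite Ey; apply: ltn_num => [|w _]; [rewrite ltnS ltnW | apply: d_lt].
  exact: ltnW (base_lt h_gt1 wown eS K_gt ylt).
apply: (@le_trans _ _ (size L)%:R); last by rewrite ler_nat.
have u_ge := cnt_pattern h_gt1 u0 uS K_gt m (kk (s j)).
have gL : g `^ (Th * (kk (s j))%:R - 1 - m%:R) <= 2 * (size L)%:R.
  apply: (@le_trans _ _ (h.+1 ^ (u (kk (s j)) - m))%:R); last first.
    rewrite -natrM ler_nat; apply: leq_trans L_size.
    by rewrite leq_exp2l ?ltnS ?(ltnW h_gt1).
  rewrite gX ler_powR ?(ltW g1) //.
  have /andP[_ ub] := u_bnd (kk (s j)).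
  have : ((u (kk (s j)))%:R <= (u (kk (s j)) - m)%:R + m%:R :> R).
    by rewrite -natrD ler_nat addnC -leq_subLR.
  by move: ub; rewrite -natr1; lra.
have xTh : x `^ Th <= V%:R `^ Th * g `^ (Th * D'%:R) * g `^ (Th * (kk (s j))%:R).
  have x0 : 0 <= x by apply: le_trans x_ge.
  apply: (@le_trans _ _ ((V * h.+1 ^ (kk (s j) + D'))%:R `^ Th)).
    by apply: ge0_ler_powR; rewrite ?nnegrE ?(ltW x_lt) ?(ltW Th0).
  rewrite natrM powRM // gX -powRrM natrD mulrDl.
  rewrite powRD; last by rewrite gN0 implybT.
  by rewrite ![_ * Th]mulrC -!mulrA [X in _ * X]mulrC.
set W := _ * g `^ (Th * D'%:R) in xTh.
have W0 : 0 < W by rewrite mulr_gt0 ?powR_gt0 ?ltr0n.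
have p0 : 0 < g `^ (-1 - m%:R) by apply: powR_gt0.
have -> : c = g `^ (-1 - m%:R) / (2 * W) by rewrite /c /W mulrA.
rewrite mulrAC ler_pdivrMr; last by rewrite (mulr_gt0 _ W0).
apply: (@le_trans _ _ (g `^ (-1 - m%:R) * (W * g `^ (Th * (kk (s j))%:R)))).
  by rewrite ler_pM2l.
rewrite [_ * (2 * _)]mulrA mulrCA [W * _]mulrC ler_pM2r // -powRD; last by rewrite gN0 implybT.
by rewrite [_%:R * 2]mulrC; apply: le_trans gL; rewrite addrC addrA.
Qed.

Let A_basis n : (h < n)%N -> sumset h AA n.
Proof. exact: (cover_AA h_gt1 wlt eS K_gt). Qed.

Let powTh (x : R) : 0 <= x -> x `^ Th = (x `^ theta) ^+ (h - 1).
Proof. by move=> x0; rewrite -powR_mulrn ?powR_ge0 // -powRrM mulrC. Qed.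

(** A single a suffices: E_a(x) is at least of order x^((h-1) theta) and at most A(x)^(h-1). *)
Let A_lower : exists2 c : R, 0 < c & exists M : R, forall x, M <= x ->
  c * x `^ theta <= (count_upto AA x)%:R.
Proof.
have [a Aa] : exists a, AA a.
  by have [f fA _] := A_basis _ (ltnSn h); exists (f (Ordinal (ltnW h_gt1))).
have [c c0 [M cE]] := E_lower _ Aa.
(* As c' <= 1, the power c'^(h-1) is at most c', hence at most c. *)
pose c' := Num.min c 1; exists c'; first by rewrite lt_min c0 ltr01.
have c'0 : 0 < c' by rewrite lt_min c0 ltr01.
exists (Num.max M 0) => x; rewrite ge_max => /andP[x_ge x0].
have h1 : (0 < h - 1)%N by rewrite subn_gt0.
have := cE x x_ge; rewrite powTh // => le_E.
rewrite -(ler_pXn2r h1) ?nnegrE // ?mulr_ge0 ?powR_ge0 ?(ltW c'0) //.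
apply: le_trans (le_trans _ le_E) _; last first.
  by rewrite -natrX ler_nat; apply: count_sums_needing; apply: ltnW.
rewrite exprMn ler_wpM2r ?exprn_ge0 ?powR_ge0 //.
apply: le_trans (_ : c' <= c); last by rewrite ge_min lexx.
by rewrite -(subnKC h1) exprS ler_piMr ?(ltW c'0) // exprn_ile1 ?(ltW c'0) // ge_min lexx orbT.
Qed.

Lemma strongly_minimal_basis_exists : exists A : set nat,
  strongly_minimal_basis R h A /\
  asymp_powR (fun x : R => (count_upto A x)%:R) theta.
Proof.
exists AA; split; last first.
  have [c c0 [M cA]] := A_lower; exists c, (C + c); split=> //.
    by rewrite ltrDr.
  exists (Num.max M 1); split; first exact: num_real.
  move=> x; rewrite gt_max => /andP[/ltW/cA-> /ltW/A_upper] /= /le_trans-> //.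
  by rewrite ler_wpM2r ?powR_ge0 // lerDl ltW.
split; first by exists h.+1 => // n /= n_ge; apply: A_basis.
move=> a Aa; have [c c0 [M cE]] := E_lower _ Aa.
have CX : 0 < C ^+ (h - 1) by rewrite exprn_gt0.
exists (c / C ^+ (h - 1)); first by rewrite divr_gt0.
exists (Num.max M 1); split; first exact: num_real.
move=> x; rewrite gt_max => /andP[/ltW/cE le_E /ltW x1].
apply: le_trans le_E; rewrite powTh; last by apply: le_trans x1.
rewrite -mulrA ler_pM2l // ler_pdivrMl // -exprMn.
have := A_upper _ x1; rewrite -(ler_pXn2r (_ : (0 < h - 1)%N)) ?subn_gt0 // nnegrE //.
by rewrite mulr_ge0 ?powR_ge0 ?(ltW C_gt0).
Qed.

End Main.

Theorem theorem1p1 (R : realType) (h : nat) (theta : R) (h_ge2 : (2 <= h)%N)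
    (theta_gt : 1 / h%:R < theta) (theta_le : theta <= 1 / (h - 1)%N%:R) :
  exists A : set nat,
    strongly_minimal_basis R h A /\
    asymp_powR (fun x : R => (count_upto A x)%:R) theta.
Proof. exact: strongly_minimal_basis_exists. Qed.
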